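(* Let $n\ge2$ and let $S\subset\mathbb{R}^n$ be a smooth strictly convex codimension-1 submanifold satisfying the standing assumptions in the context. Then for every compactly supported $g\in L^2(S)$, $$|\widehat{g\,\mathrm{d}\sigma}|^2=X_S^*W_S(g,g),$$ where $X_Sw(u,v):=\int_{-\infty}^{\infty}w(v+tN(u))\,\mathrm{d}t$ for $u\in S$, $v\in T_uS$, i.e. $X_S$ is the pullback of the X-ray transform under the Gauss map $TS\ni(u,v)\mapsto(N(u),v)\in T\mathbb{S}^{n-1}$. Explicitly, for a function $h$ on the tangent bundle $TS$, $X_S^*h(x)=\int_Sh(u,P_{T_uS}x)\,\mathrm{d}\sigma(u)$.
   Context: $S$ has surface measure $\mathrm{d}\sigma$ and Gauss map (smooth unit normal) $N:S\to\mathbb{S}^{n-1}$; $T_uS=\langle N(u)\rangle^\perp$; $P_{T_uS}$ is the orthogonal projection of $\mathbb{R}^n$ onto $T_uS$. $\widehat{g\,\mathrm{d}\sigma}(x)=\int_Sg(u)e^{-2\pi ix\cdot u}\,\mathrm{d}\sigma(u)$. **Standing assumptions.** The shape operator $\mathrm{d}N_u:T_uS\to T_uS$ is positive definite at every $u\in S$ (strict convexity); $N(S)$ is geodesically convex (its intersection with any great circle is connected); the maps $u\mapsto R_uu'$, $u'\mapsto R_uu'$ below are differentiable away from $u=u'$; and, for each $u'$, the map $u\mapsto R_uu'$ is a bijection so that the change of variables formula defining $J$ below holds (in the paper this is attributed to the geodesic convexity of $N(S)$). **The map $R_u$.** For $u\ne u'$ in $S$, $u''=R_uu'$ is the unique point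 of $S$ with $u''\neq u'$, $(u'-u'')\cdot N(u)=0$ and $N(u)\wedge N(u')\wedge N(u'')=0$ (vacuous if $n=2$); $R_uu:=u$. If $S$ is not closed such a point need not exist; all integrals over $S$ involving $R_uu'$ are taken over those points for which it exists in $S$. **The Jacobian $J$.** For fixed $u'$, $J(u,u')$ is the Jacobian factor of $u\mapsto R_uu'$ with respect to surface measure, so that $\int_S\Phi(R_uu')J(u,u')\,\mathrm{d}\sigma(u)=\int_S\Phi\,\mathrm{d}\sigma$. **Wigner transform on $S$.** For compactly supported $g_1,g_2\in L^2(S)$, $u\in S$, $v\in T_uS$, $$W_S(g_1,g_2)(u,v)=\int_Sg_1(u')\overline{g_2(R_uu')}e^{-2\pi iv\cdot(u'-R_uu')}J(u,u')\,\mathrm{d}\sigma(u').$$ *)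

(* Defs.v *)
From mathcomp Require Import all_boot all_order all_algebra.
From mathcomp Require Import all_classical all_reals all_analysis.
From mathcomp Require Import measurable_realfun complex.

Set Implicit Arguments.
Unset Strict Implicit.
Unset Printing Implicit Defensive.

Import Order.TTheory GRing.Theory Num.Theory.
Import numFieldNormedType.Exports.

Local Open Scope classical_set_scope.
Local Open Scope ring_scope.

(* Vectors of R^n are row vectors; a matrix L acts on them by v |-> v *m L.
   The library norm on 'rV[R]_n is the sup norm: it is used below only for
   topological notions and little-o estimates, while all metric notions go
   through the Euclidean inner product [dot]. *)

Definition dot (R : realType) (n : nat) (x y : 'rV[R]_n) : R :=
  (x *m y^T) 0 0.

Notation borelRV R n := (g_sigma_algebraType (@open 'rV[R]_n)).

Section SmoothMaps.
Context {R : realType} {U W : normedModType R}.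

Fixpoint Ck (k : nat) (V : set U) (f : U -> W) : Prop :=
  match k with
  | 0%N => forall y, V y -> {for y, continuous f}
  | k'.+1 => (forall y, V y -> differentiable f y) /\
             (forall v, Ck k' V (fun y => 'D_v f y))
  end.

Definition smooth_on (V : set U) (f : U -> W) : Prop := forall k, Ck k V f.

End SmoothMaps.

Section Hypersurface.
Context {R : realType} {n : nat}.
Local Notation E := 'rV[R]_n.
Local Notation P := 'rV[R]_n.-1.

(* Smooth local parametrization of S: an immersion of the open set V which is
   a homeomorphism onto a relatively open subset of S. *)
Record is_chart (S : set E) (V : set P) (phi : P -> E) : Prop := {
  chart_open : open V ;
  chart_smooth : smooth_on V phi ;
  chart_sub : phi @` V `<=` S ;
  chart_immersion : forall y, V y -> row_free ('J phi y) ;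
  chart_inj : {in V &, injective phi} ;
  chart_relopen : forall V' : set P, open V' -> V' `<=` V ->
    exists2 O : set E, open O & phi @` V' = O `&` S }.

Definition smooth_hypersurface (S : set E) : Prop :=
  forall p, S p -> exists V phi, is_chart S V phi /\ (phi @` V) p.

Record is_gauss_map (S : set E) (N : E -> E) : Prop := {
  gauss_unit : forall u, S u -> dot (N u) (N u) = 1 ;
  gauss_normal : forall V phi, is_chart S V phi ->
    forall y, V y -> 'J phi y *m (N (phi y))^T = 0 ;
  gauss_smooth : forall V phi, is_chart S V phi -> smooth_on V (N \o phi) }.

(* The values on boxes determine the Borel measure lam. *)
Definition is_lebesgue (m : nat)
    (lam : {measure set (borelRV R m) -> \bar R}) : Prop :=
  forall a b : 'rV[R]_m, (forall i, a 0 i <= b 0 i) ->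
    lam [set y : 'rV[R]_m | forall i, a 0 i < y 0 i <= b 0 i] =
    (\prod_(i < m) (b 0 i - a 0 i))%:E.

(* In a chart, dsigma = sqrt (det (gram matrix)) dy. The measure
   lives on R^n and is carried by S. *)
Definition is_surface_measure (S : set E)
    (sigma : {measure set (borelRV R n) -> \bar R}) : Prop :=
  sigma (~` S) = 0%E /\
  exists2 lam : {measure set (borelRV R n.-1) -> \bar R}, is_lebesgue lam &
    forall V phi, is_chart S V phi ->
    forall B : set (borelRV R n), measurable B -> B `<=` phi @` V ->
      sigma B = (\int[lam]_(y in V `&` phi @^-1` B)
        (Num.sqrt (\det ('J phi y *m ('J phi y)^T)))%:E)%E.

(* L is a derivative at u, relative to S, of the partial map F with domain D;
   as for any derivative, F has to be defined near u (in S). Only the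
   restriction of L to the tangent space is meaningful. *)
Definition is_tderiv (S D : set E) (F : E -> E) (u : E) (L : 'M[R]_n) : Prop :=
  (\forall w \near within S (nbhs u), D w) /\
  (forall e : R, 0 < e -> \forall w \near within S (nbhs u),
    `|F w - F u - (w - u) *m L| <= e * `|w - u|).

Definition tdifferentiable (S D : set E) (F : E -> E) (u : E) : Prop :=
  exists L, is_tderiv S D F u L.

Section Gauss.
Variables (S : set E) (N : E -> E).

Definition tangent (u : E) : set E := [set v | dot v (N u) = 0].

Definition tproj (u x : E) : E := x - dot x (N u) *: N u.

(* The derivative of F at u as a matrix; its values on T_uS are those of the
   differential, and it is extended by 0 to the normal line. *)
Definition tderiv (D : set E) (F : E -> E) (u : E) : 'M[R]_n :=
  get [set L | is_tderiv S D F u L /\ N u *m L = 0].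

Definition shape (u v : E) : E := v *m tderiv S N u.

(* Great circles are the intersections of the sphere with 2-planes. *)
Definition great_circle (Q : 'M[R]_(2, n)) : set E :=
  [set x : E | dot x x = 1 /\ (x <= Q)%MS].

Definition geodesically_convex (A : set E) : Prop :=
  forall Q : 'M[R]_(2, n), \rank Q = 2%N -> connected (A `&` great_circle Q).

(* The defining relation of u'' = R_u u' for u != u'. The vanishing of the
   wedge product of three vectors is their linear dependence. *)
Definition Rrel (u u' u'' : E) : Prop :=
  [/\ S u'', u'' <> u', dot (u' - u'') (N u) = 0 &
      (\rank (col_mx (N u) (col_mx (N u') (N u''))) < 3)%N].

Definition Rexists (u u' : E) : Prop :=
  u = u' \/ exists! u'', Rrel u u' u''.

(* Only meaningful if [Rexists u u']. *)
Definition Rmap (u u' : E) : E :=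
  if u == u' then u' else xget u' [set u'' | Rrel u u' u''].

Definition Rdom1 (u' : E) : set E := [set u | S u /\ Rexists u u'].

Definition Rdom2 (u : E) : set E := [set u' | S u' /\ Rexists u u'].

(* Jacobian factor of u |-> R_u u'. With L the differential, extended by 0 to
   the normal line, L *m L^T is the gram matrix of L on T_uS, extended by 0;
   adding the projection onto the normal line makes its determinant the gram
   determinant of L on T_uS. *)
Definition Jac (u u' : E) : R :=
  let L := tderiv (Rdom1 u') (Rmap ^~ u') u in
  Num.sqrt (\det (L *m L^T + (N u)^T *m N u)).

Record standing_assumptions
    (sigma : {measure set (borelRV R n) -> \bar R}) : Prop := {
  shape_posdef : forall u v, S u -> tangent u v -> v <> 0 ->
    0 < dot (shape u v) v ;
  gauss_convex : geodesically_convex (N @` S) ;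
  Rmap_diff1 : forall u u', Rdom1 u' u -> S u' -> u <> u' ->
    tdifferentiable S (Rdom1 u') (Rmap ^~ u') u ;
  Rmap_diff2 : forall u u', S u -> Rdom2 u u' -> u <> u' ->
    tdifferentiable S (Rdom2 u) (Rmap u) u' ;
  Rmap_bij : forall u', S u' -> set_bij (Rdom1 u') S (Rmap ^~ u') ;
  Rmap_change_of_variables : forall u', S u' ->
    forall Phi : borelRV R n -> \bar R, measurable_fun (S : set (borelRV R n)) Phi ->
    (forall u, S u -> (0 <= Phi u)%E) ->
    (\int[sigma]_(u in Rdom1 u') (Phi (Rmap u u') * (Jac u u')%:E) =
     \int[sigma]_(u in S) Phi u)%E }.

End Gauss.

Section Wigner.
Variables (S : set E) (N : E -> E).
Variable sigma : {measure set (borelRV R n) -> \bar R}.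

Definition Cintegral (D : set E) (f : E -> R[i]) : R[i] :=
  Complex (\int[sigma]_(u in D) complex.Re (f u))
          (\int[sigma]_(u in D) complex.Im (f u)).

Definition exp_m2ipi (t : R) : R[i] :=
  Complex (cos (2 * pi * t)) (- sin (2 * pi * t)).

Definition L2_on (g : E -> R[i]) : Prop :=
  [/\ measurable_fun (S : set (borelRV R n)) (fun u => complex.Re (g u)),
      measurable_fun (S : set (borelRV R n)) (fun u => complex.Im (g u)) &
      (\int[sigma]_(u in S)
        (complex.Re (g u) ^+ 2 + complex.Im (g u) ^+ 2)%:E < +oo)%E].

Definition compactly_supported (g : E -> R[i]) : Prop :=
  exists K : set E, [/\ compact K, K `<=` S &
    {ae sigma, forall u, S u -> ~ K u -> g u = 0}].

Definition fourier (g : E -> R[i]) (x : E) : R[i] :=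
  Cintegral S (fun u => g u * exp_m2ipi (dot x u)).

Definition wigner (g1 g2 : E -> R[i]) (u v : E) : R[i] :=
  Cintegral (Rdom2 S N u) (fun u' =>
    g1 u' * conjc (g2 (Rmap S N u u')) *
    exp_m2ipi (dot v (u' - Rmap S N u u')) * (Jac S N u u')%:C%C).

(* The adjoint of X_S w (u, v) = \int w (v + t N(u)) dt, for the measure
   dv dsigma(u) on the tangent bundle TS, in explicit form. A function on TS is
   h : E -> E -> R[i], whose values matter only at (u, v) with v in T_uS. *)
Definition XSstar (h : E -> E -> R[i]) (x : E) : R[i] :=
  Cintegral S (fun u => h u (tproj N u x)).

End Wigner.

End Hypersurface.

(* Main.v *)
Require Import Defs.
From HB Require Import structures.
From mathcomp Require Import all_boot all_order all_algebra finmap.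
From mathcomp Require Import all_classical all_reals all_analysis.
From mathcomp Require Import measurable_realfun complex lra ring.

Set Implicit Arguments.
Unset Strict Implicit.
Unset Printing Implicit Defensive.

Import Order.TTheory GRing.Theory Num.Theory.
Import numFieldNormedType.Exports.

Local Open Scope classical_set_scope.
Local Open Scope ring_scope.

(** Put [G u = g u * e(- x . u)], where [e t] is the exponential of [2 pi i t].
Since [u' - R_u u'] is orthogonal to [N u], projecting [x] onto the tangent
space at [u] does not change the phase of the Wigner transform, and the
integrand of [XSstar] of the Wigner transform at [x] becomes
[G u' * conj (G (R_u u')) * J (u, u')].  For fixed [u'], the change of variables
[u |-> R_u u'] turns the integral in [u] into [conj (\int_S G)], which does not
depend on [u'], and the integral in [u'] then gives [|\int_S G| ^ 2].  So the
theorem is an exchange of two integrals over [S] ([wigner_integral]).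

The substance is to justify this exchange.  It needs sigma-finiteness of the
surface measure, integrability of [G], and joint Borel measurability of the
integrand in [(u, u')].

Sigma-finiteness comes from a countable cover of [S] by compact chart images of
finite measure ([countable_pieces]); integrability of [G] comes from finiteness
on the compact support ([compact_surface_fin], [integrable_L2_support]).

Joint measurability is not a consequence of the differentiability in each
variable separately: already the domain of [(u, u') |-> R_u u'] need not be
Borel just because its slices are relatively open.  It is obtained instead from
sigma-compactness.  The cover above shows that [S] and the graph of the Gauss
map are sigma-compact.  The relation between [u], [u'] and [R_u u'] is given by
closed conditions on points and normals, together with [u'' <> u'], so its graph
is sigma-compact ([Rgraph_sigma_compact]).  Projections of sigma-compact sets
are sigma-compact, hence Borel, and [Rdom] and [R] are measurable
([measurable_Rdom], [measurable_Rmap]).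

For the Jacobian, the differential of [u |-> R_u u'] has to be a measurable
function of [(u, u')].  The failure, for a given matrix, of the difference
quotient estimate is again the projection of a sigma-compact set
([bad_secant_sigma_compact]).  The differential is determined by such estimates
for matrices with rational entries ([tderiv_entry_le]), because the secants of
[S] at [u] see all tangent directions ([tangent_detect]) and miss the normal
direction to first order ([secant_normal]).  Points of the diagonal are
left out throughout; they form a null set in each slice. *)

(** * Sigma-compact sets *)

Definition sigma_compact {T : topologicalType} (A : set T) :=
  exists2 K : nat -> set T, (forall i, compact (K i)) & A = \bigcup_i K i.

Lemma compact_sigma_compact (T : topologicalType) (A : set T) :
  compact A -> sigma_compact A.
Proof.
by move=> cA; exists (fun=> A) => //; rewrite bigcup_const.
Qed.

Lemma sigma_compact_bigcup (T : topologicalType) (I : countType)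
    (P : I -> Prop) (A : I -> set T) :
  (forall i, P i -> sigma_compact (A i)) ->
  sigma_compact (\bigcup_(i in P) A i).
Proof.
move=> hA.
have /choice[K hK] : forall i, exists K : nat -> set T,
    P i -> (forall k, compact (K k)) /\ A i = \bigcup_k K k.
  move=> i.
  have [Pi|nPi] := pselect (P i); last by exists (fun=> set0).
  by have [K cK AK] := hA _ Pi; exists K.
pose L m := if @choice.unpickle (I * nat)%type m is Some (i, k) then
  if `[< P i >] then K i k else set0 else set0.
exists L => [m|].
  rewrite /L; case: choice.unpickle => [[i k]|]; last exact: compact0.
  by case: asboolP => [Pi|_]; [have [] := hK _ Pi|exact: compact0].
apply/seteqP; split => [x [i Pi]|x [m _]].
  have [_ ->] := hK _ Pi => -[k _ Kx]; exists (choice.pickle (i, k)) => //.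
  by rewrite /L choice.pickleK asboolT.
rewrite /L; case: choice.unpickle => [[i k]|//]; case: asboolP => // Pi Kx.
by exists i => //; have [_ ->] := hK _ Pi; exists k.
Qed.

Lemma sigma_compactI_closed (T : topologicalType) (A F : set T) :
  sigma_compact A -> closed F -> sigma_compact (A `&` F).
Proof.
move=> [K cK ->] cF; exists (fun i => K i `&` F); last by rewrite setI_bigcupl.
by move=> i; exact: compact_closedI.
Qed.

(** The open condition is the countable union of the closed ones [1 / (k + 1) <= f]. *)
Lemma sigma_compactI_gt0 (R : realType) (T : topologicalType) (A : set T)
    (f : T -> R) : continuous f ->
  sigma_compact A -> sigma_compact (A `&` [set x | 0 < f x]).
Proof.
move=> cf sA.
suff -> : A `&` [set x | 0 < f x] =
    \bigcup_(k : nat) (A `&` f @^-1` [set y | k.+1%:R^-1 <= y]).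
  apply: sigma_compact_bigcup => k _; apply: sigma_compactI_closed => //.
  by apply: closed_comp => //; exact: closed_ge.
apply/seteqP; split => [x [Ax /= fx]|x [k _ [Ax /= fx]]].
  have [k /ltW hk] := ltr_add_invr fx.
  by exists k => //; split => //=; rewrite add0r in hk.
by split => //=; apply: lt_le_trans fx; rewrite invr_gt0.
Qed.

Lemma sigma_compact_image (T U : topologicalType) (f : T -> U) (A : set T) :
  continuous f -> sigma_compact A -> sigma_compact (f @` A).
Proof.
move=> cf [K cK ->]; exists (fun i => f @` K i); last by rewrite image_bigcup.
move=> i; apply: continuous_compact (cK i).
exact: continuous_subspaceT.
Qed.

Lemma sigma_compact_setX (T U : topologicalType) (A : set T) (B : set U) :
  sigma_compact A -> sigma_compact B -> sigma_compact (A `*` B).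
Proof.
move=> [K cK ->] [L cL ->].
suff -> : (\bigcup_i K i) `*` (\bigcup_i L i) =
    \bigcup_(p : nat * nat) (K p.1 `*` L p.2).
  by apply: sigma_compact_bigcup => p _; apply: compact_sigma_compact;
    exact: compact_setX.
apply/seteqP; split => [[x y] [[i _ Kx] [j _ Ly]]|[x y] [[i j] _ [/= Kx Ly]]].
  by exists (i, j).
by split; [exists i|exists j].
Qed.

Definition rational_ball (R : realType) (n : nat) (c : 'rV[rat]_n * nat) :
  set 'rV[R]_n := ball (map_mx (@ratr R) c.1 : 'rV[R]_n) c.2.+1%:R^-1.

(** A countable basis of the topology: it reduces covers to countable ones, and open sets
of the product to countable unions of rectangles. *)
Lemma rational_ball_basis (R : realType) (n : nat) (x : 'rV[R]_n) (A : set 'rV[R]_n) :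
  nbhs x A -> exists c, @rational_ball R n c x /\ @rational_ball R n c `<=` A.
Proof.
move=> /nbhs_ballP[e /= e0 he].
have [k hk] := ltr_add_invr (divr_gt0 e0 (ltr0n R 2)).
rewrite add0r in hk.
have hq (j : 'I_n) : exists q : rat, `|x 0 j - ratr q| < (k.+1%:R^-1 : R).
  have [|q] := @rat_in_itvoo R (x 0 j - k.+1%:R^-1) (x 0 j + k.+1%:R^-1).
    by rewrite ltrBlDr -addrA ltrDl addr_gt0 ?invr_gt0.
  rewrite in_itv/= => /andP[h1 h2]; exists q.
  by rewrite ltr_distlC h1 h2.
have [q Hq] := choice hq.
have xq : @rational_ball R n (\row_j q j, k) x.
  split; first by rewrite invr_gt0.
  move=> i j; rewrite !mxE /ball /= distrC (ord1 i); exact: Hq.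
exists (\row_j q j, k); split=> // y qy; apply: he.
apply: (@le_ball _ _ x (k.+1%:R^-1 + k.+1%:R^-1)).
  by rewrite [e]splitr lerD ?ltW.
by apply: ball_triangle qy; apply: ball_sym.
Qed.

Lemma measurable_openRV (R : realType) n (O : set 'rV[R]_n) :
  open O -> measurable (O : set (borelRV R n)).
Proof. by move=> oO; apply: sub_sigma_algebra. Qed.

Lemma measurable_closedRV (R : realType) n (F : set 'rV[R]_n) :
  closed F -> measurable (F : set (borelRV R n)).
Proof.
move=> cF; rewrite -[F]setCK; apply: measurableC; apply: measurable_openRV.
exact: closed_openC.
Qed.

(** Open sets of the product are countable unions of rectangles of rational balls. *)
Lemma measurable_openRV2 (R : realType) n (O : set ('rV[R]_n * 'rV[R]_n)) :
  open O -> measurable (O : set (borelRV R n * borelRV R n)).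
Proof.
move=> oO.
have -> : O = \bigcup_(p in [set p : ('rV[rat]_n * nat) * ('rV[rat]_n * nat) |
   rational_ball p.1 `*` rational_ball p.2 `<=` O])
     (@rational_ball R n p.1 `*` rational_ball p.2).
  apply/seteqP; split => [[x y] Oxy|[x y] [p /= hp pxy]]; last exact: hp.
  have : nbhs (x, y) O by exact: open_nbhs_nbhs.
  move=> [[A B] /= [/rational_ball_basis[c [cx hc]] /rational_ball_basis[d [dy hd]]] AB].
  exists (c, d) => //= -[a b] [/= /hc Aa /hd Bb]; exact: AB.
rewrite bigcup_mkcond; apply: countable_bigcupT_measurable => // p.
case: ifP => // _; apply: measurableX; apply: measurable_openRV; exact: ball_open.
Qed.

Lemma sigma_compact_measurableRV (R : realType) n (A : set 'rV[R]_n) :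
  sigma_compact A -> measurable (A : set (borelRV R n)).
Proof.
move=> [K cK ->]; apply: bigcup_measurable => i _.
apply: measurable_closedRV; apply: compact_closed (cK i).
exact: norm_hausdorff.
Qed.

Lemma sigma_compact_measurableRV2 (R : realType) n (A : set ('rV[R]_n * 'rV[R]_n)) :
  sigma_compact A -> measurable (A : set (borelRV R n * borelRV R n)).
Proof.
move=> [K cK ->]; apply: bigcup_measurable => i _.
rewrite -[K i]setCK; apply: measurableC; apply: measurable_openRV2.
apply: closed_openC; apply: compact_closed (cK i).
exact: norm_hausdorff.
Qed.

(** * Charts and the surface measure *)

(** Convergence of the determinant and of the products below is stated for an abstract
filter, to be used at points of spaces of matrices. *)
Lemma cvg_det (R : realType) (T : Type) (F : set_system T) {FF : Filter F} m
    (A : T -> 'M[R]_m) (L : 'M[R]_m) :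
  (forall i j, A t i j @[t --> F] --> L i j) ->
  \det (A t) @[t --> F] --> \det L.
Proof.
move=> AL; rewrite /determinant.
apply: (@cvg_big _ _ +%R); first exact: add_continuous.
move=> s _; apply: cvgM; first exact: cvg_cst.
apply: (@cvg_big R _ (@GRing.mul R)); first exact: mul_continuous.
by move=> i _; exact: AL.
Qed.

Lemma cvg_mulmx (R : realType) (T : Type) (F : set_system T) {FF : Filter F} m n p
    (A : T -> 'M[R]_(m, n)) (B : T -> 'M[R]_(n, p)) (L : 'M[R]_(m, n)) (M : 'M[R]_(n, p)) :
  (forall i j, A t i j @[t --> F] --> L i j) ->
  (forall i j, B t i j @[t --> F] --> M i j) ->
  forall i j, (A t *m B t) i j @[t --> F] --> (L *m M) i j.
Proof.
move=> AL BM i j; rewrite mxE; under eq_cvg do rewrite mxE.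
apply: (@cvg_big _ _ +%R); first exact: add_continuous.
by move=> k _; apply: cvgM.
Qed.

Lemma cvg_gram (R : realType) (T : Type) (F : set_system T) (FF : Filter F) m n
    (A : T -> 'M[R]_(m, n)) (L : 'M[R]_(m, n)) :
  (forall i j, A t i j @[t --> F] --> L i j) ->
  Num.sqrt (\det (A t *m (A t)^T)) @[t --> F] --> Num.sqrt (\det (L *m L^T)).
Proof.
move=> AL.
apply: (@cvg_comp _ _ _ (fun t => \det (A t *m (A t)^T)) Num.sqrt
  _ (nbhs (\det (L *m L^T)))); last exact: sqrt_continuous.
apply: cvg_det; apply: cvg_mulmx => // i j.
by rewrite mxE; under eq_cvg do rewrite mxE; exact: AL.
Qed.

Section le_integral.
Import HBNNSimple.

(** Monotonicity without any measurability: the integral of a nonnegative function is a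
supremum over the simple functions below it. *)
Lemma ge0_le_integralS d (T : measurableType d) (R : realType)
    (mu : {measure set T -> \bar R}) (D : set T) (f g : T -> \bar R) :
  (forall x, D x -> 0 <= f x)%E -> (forall x, D x -> f x <= g x)%E ->
  (\int[mu]_(x in D) f x <= \int[mu]_(x in D) g x)%E.
Proof.
move=> f0 fg.
have g0 x : D x -> (0 <= g x)%E by move=> Dx; apply: le_trans (fg _ Dx); exact: f0.
rewrite !ge0_integralE//; apply: ereal_sup_le => _ [h /= hf <-].
exists h => //= x.
by apply: le_trans (hf x) _; apply: lee_restrict.
Qed.

End le_integral.

Section charts.
Variables (R : realType) (n : nat).
Local Notation E := 'rV[R]_n.
Local Notation P := 'rV[R]_n.-1.
Implicit Types (S : set E) (N : E -> E).

Lemma chart_continuous S V phi : is_chart S V phi ->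
  forall y : P, V y -> {for y, continuous phi}.
Proof. by move=> h y Vy; exact: (chart_smooth h 0). Qed.

Lemma chart_differentiable S V phi : is_chart S V phi ->
  forall y : P, V y -> differentiable phi y.
Proof. by move=> h y Vy; have [/(_ y Vy)] := chart_smooth h 1. Qed.

Lemma gauss_chart_continuous S N V phi : is_gauss_map S N -> is_chart S V phi ->
  forall y : P, V y -> {for y, continuous (N \o phi)}.
Proof. by move=> hN h y Vy; exact: (gauss_smooth hN h 0). Qed.

(** The entries of the Jacobian matrix are coordinates of directional derivatives, which
are continuous on a chart. *)
Lemma chart_jacobian_cvg S V phi : is_chart S V phi ->
  forall y : P, V y -> forall i j, 'J phi z i j @[z --> y] --> 'J phi y i j.
Proof.
move=> h y Vy i j.
have JE z : V z -> 'J phi z i j = 'D_(delta_mx 0 i) phi z 0 j.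
  move=> Vz; rewrite deriveEjacobian; last exact: chart_differentiable h _ Vz.
  by rewrite -rowE [RHS]mxE.
apply: (eq_ind_r (fun t => 'J phi z i j @[z --> y] --> t) _ (JE y Vy)).
have cD : 'D_(delta_mx 0 i) phi z @[z --> y] --> 'D_(delta_mx 0 i) phi y.
  by have [_ hD] := chart_smooth h 1; exact: (hD (delta_mx 0 i) y Vy).
have cc := cvg_comp _ _ cD (@coord_continuous R 1 n 0 j _).
have nV : nbhs y V by exact: (open_nbhs_nbhs (conj (chart_open h) Vy)).
apply: cvg_trans cc; apply: near_eq_cvg.
  exact: (nbhs_filter y).
by apply: (@filterS _ (nbhs y) _ V) nV => z Vz; exact: (esym (JE z Vz)).
Qed.

Lemma chart_gram_cvg S V phi : is_chart S V phi -> forall y : P, V y ->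
  Num.sqrt (\det ('J phi z *m ('J phi z)^T)) @[z --> y] -->
  Num.sqrt (\det ('J phi y *m ('J phi y)^T)).
Proof.
by move=> h y Vy; exact: (cvg_gram (nbhs_filter y) (chart_jacobian_cvg h Vy)).
Qed.

End charts.

Lemma measurable_set1RV (R : realType) n (x : 'rV[R]_n) :
  measurable ([set x] : set (borelRV R n)).
Proof.
apply: measurable_closedRV; apply: accessible_closed_set1.
apply: hausdorff_accessible; exact: norm_hausdorff.
Qed.

Section boxes.
Variables (R : realType) (m : nat).

Definition half_open_box (a b : 'rV[R]_m) : set (borelRV R m) :=
  [set y : 'rV[R]_m | forall i, a 0 i < y 0 i <= b 0 i].

Lemma measurable_half_open_box (a b : 'rV[R]_m) : measurable (half_open_box a b).
Proof.
rewrite [X in measurable X](_ : _ = \bigcap_(i in [set: 'I_m])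
    ([set y : 'rV[R]_m | a 0 i < y 0 i] `&` [set y : 'rV[R]_m | y 0 i <= b 0 i])); last first.
  apply/seteqP; split => [y h i _|y h i]; first by have /andP[] := h i.
  by have [/= -> ->] := h i I.
apply: (@fin_bigcap_measurable _ (borelRV R m)) => // i _.
apply: (@measurableI _ (borelRV R m)).
  apply: measurable_openRV.
  apply: (@open_comp _ _ (fun y : 'rV[R]_m => y 0 i) [set t | a 0 i < t]).
    by move=> y _; exact: coord_continuous.
  exact: open_gt.
apply: measurable_closedRV.
apply: (@closed_comp _ _ (fun y : 'rV[R]_m => y 0 i) [set t | t <= b 0 i]).
  by move=> y _; exact: coord_continuous.
exact: closed_le.
Qed.

Variable lam : {measure set (borelRV R m) -> \bar R}.
Hypothesis hlam : is_lebesgue lam.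

Lemma lebesgue_closed_ball_fin (y : 'rV[R]_m) (r : R) : 0 < r ->
  (lam (closed_ball y r) < +oo)%E.
Proof.
move=> r0; pose a : 'rV[R]_m := \row_i (y 0 i - r - 1).
pose b : 'rV[R]_m := \row_i (y 0 i + r).
have ab i : a 0 i <= b 0 i.
  by rewrite !mxE -addrA lerD2l lerBlDr (le_trans (y := 0)) ?oppr_le0 ?ltW ?addr_gt0.
apply: (@le_lt_trans _ _ (lam (half_open_box a b))).
  apply: le_measure; rewrite ?inE.
  - by apply: measurable_closedRV; exact: closed_ball_closed.
  - exact: measurable_half_open_box.
  - move=> z; rewrite closed_ballE// /closed_ball_/= => yz i.
    have : `|y 0 i - z 0 i| <= r.
      apply: le_trans yz; rewrite -[y 0 i - _]/(y 0 i - z 0 i).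
      rewrite [leRHS]/Num.Def.normr/= mx_normrE.
      by apply: (le_trans _ (le_bigmax _ _ (0, i))); rewrite /= !mxE.
    rewrite !mxE ler_distlC => /andP[h1 h2].
    by rewrite h2 andbT (lt_le_trans _ h1)// ltrBlDr ltrDl.
by rewrite /half_open_box hlam// ltry.
Qed.

(** A point lies in half-open cubes of arbitrarily small side [d <= 1], of volume at most [d]. *)
Lemma lebesgue_point0 (y : 'rV[R]_m) : (0 < m)%N -> lam [set y] = 0%E.
Proof.
move=> m0; apply/eqP; rewrite eq_le measure_ge0 andbT.
apply/lee_addgt0Pr => e e0; rewrite add0e.
pose d := Num.min e 1.
have d0 : 0 < d by rewrite lt_min e0 ltr01.
pose a : 'rV[R]_m := \row_i (y 0 i - d).
have ay i : a 0 i <= y 0 i by rewrite mxE gerBl ltW.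
apply: (@le_trans _ _ (lam (half_open_box a y))).
  apply: le_measure; rewrite ?inE.
  - exact: measurable_set1RV.
  - exact: measurable_half_open_box.
  - by move=> _ -> i; rewrite lexx mxE gtrBl d0.
rewrite /half_open_box hlam// lee_fin.
under eq_bigr do rewrite mxE opprB addrC subrK.
rewrite prodr_const card_ord.
have d1 : d <= 1 by rewrite ge_min lexx orbT.
apply: (le_trans (y := d)); last by rewrite ge_min lexx.
by case: m m0 => // k _; rewrite exprS ler_piMr// ?exprn_ile1// ltW.
Qed.

End boxes.

Section pieces.
Variables (R : realType) (n : nat) (S : set 'rV[R]_n) (N : 'rV[R]_n -> 'rV[R]_n).
Variable (sigma : {measure set (borelRV R n) -> \bar R}).
Hypotheses (hS : smooth_hypersurface S) (hN : is_gauss_map S N).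
Hypothesis (hsigma : is_surface_measure S sigma).

(** The compact piece is the image of a closed ball so small that the area density stays
below its value at the centre plus one; the open set is the one that cuts the image
of the interior of this ball out of [S]. *)
Lemma local_piece p : S p -> exists OK : set 'rV[R]_n * set 'rV[R]_n,
  [/\ open OK.1, OK.1 p, OK.1 `&` S `<=` OK.2, OK.2 `<=` S &
   [/\ compact OK.2, (sigma OK.2 < +oo)%E &
    compact ((fun u => (u, N u)) @` OK.2)]].
Proof.
move=> Sp; have [V [phi [hc [y Vy yp]]]] := hS Sp.
have [_ [lam hlam sE]] := hsigma.
pose h (z : 'rV[R]_n.-1) : R := Num.sqrt (\det ('J phi z *m ('J phi z)^T)).
have hy : \forall z \near y, V z /\ h z < h y + 1.
  apply: filterI.
    exact: (open_nbhs_nbhs (conj (chart_open hc) Vy)).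
  have hcv : h z @[z --> y] --> h y := chart_gram_cvg hc Vy.
  have hlt : h y < h y + 1 by rewrite ltrDl.
  have := @cvgr_lt R _ (nbhs y) (nbhs_filter y) h (h y) hcv _ hlt.
  exact.
have [r /= r0 hr] := (nbhs_ballP _ _).1 hy.
have r20 : 0 < r / 2 by rewrite divr_gt0.
pose C := closed_ball y (r / 2).
have CV z : C z -> V z /\ h z < h y + 1.
  move=> Cz; apply: hr; apply: closed_ball_subset Cz => //.
  by rewrite ltr_pdivrMr// ltr_pMr// ltr1n.
have CsV : C `<=` V by move=> z /CV[].
have cC : compact C.
  apply: bounded_closed_compact; last exact: closed_ball_closed.
  exists (`|y| + r / 2); split; first exact: num_real.
  move=> M hM z; rewrite /C closed_ballE// /closed_ball_/= => yz.
  rewrite (le_trans _ (ltW hM))// -[z](subKr y) (le_trans (ler_normB _ _))//.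
  by rewrite lerD2l.
have iV : C° `<=` V by apply: subset_trans CsV; exact: interior_subset.
have [U oU hU] := chart_relopen hc (@open_interior _ C) iV.
exists (U, phi @` C) => /=.
have Oy : (phi @` C°) p.
  exists y => //; rewrite /interior; apply/nbhs_ballP.
  by exists (r / 2) => //; exact: subset_closed_ball.
have cphi : {within C, continuous phi}.
  apply: continuous_in_subspaceT => z; rewrite inE => /CsV Vz.
  exact: chart_continuous hc z Vz.
have cK : compact (phi @` C) by exact: continuous_compact.
have KS : phi @` C `<=` S.
  by apply: subset_trans (chart_sub hc); exact: image_subset.
split=> //.
- by move: Oy; rewrite hU => -[].
- by rewrite -hU; apply: image_subset; exact: interior_subset.
split=> //; last first.
  rewrite image_comp.
  apply: continuous_compact cC; apply: continuous_in_subspaceT => z.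
  rewrite inE => /CsV Vz.
  exact: (cvg_pair (chart_continuous hc Vz) (gauss_chart_continuous hN hc Vz)).
rewrite (sE _ _ hc); last 2 first.
- by apply: measurable_closedRV; apply: compact_closed cK; exact: norm_hausdorff.
- exact: image_subset.
have -> : V `&` phi @^-1` (phi @` C) = C.
  apply/seteqP; split => [z [Vz [w Cw /(chart_inj hc)]]|z Cz].
    by rewrite !inE => <-//; exact: CsV.
  by split; [exact: CsV|exists z].
apply: le_lt_trans (_ : \int[lam]_(z in C) (h y + 1)%:E < +oo)%E.
  apply: ge0_le_integralS => z Cz; rewrite lee_fin ?sqrtr_ge0//.
  by apply/ltW; have [] := CV _ Cz.
rewrite integral_cst; last by apply: measurable_closedRV; exact: closed_ball_closed.
by rewrite lte_mul_pinfty// ?lee_fin ?addr_ge0 ?sqrtr_ge0// lebesgue_closed_ball_fin.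
Qed.

Lemma surface_point0 p : (2 <= n)%N -> S p -> sigma [set p] = 0%E.
Proof.
move=> n2 Sp; have [V [phi [hc [y Vy yp]]]] := hS Sp.
have [_ [lam hlam sE]] := hsigma.
rewrite (sE _ _ hc); last 2 first.
- exact: measurable_set1RV.
- by move=> _ ->; exists y.
have -> : V `&` phi @^-1` [set p] = [set y].
  apply/seteqP; split => [z [Vz /= pz]|_ -> //].
  by apply: (chart_inj hc); rewrite ?inE// pz.
have m1 := @measurable_set1RV R n.-1 y.
rewrite null_set_integral//; first exact: measurable_fun_set1.
by rewrite lebesgue_point0// -ltnS prednK// (leq_trans _ n2).
Qed.

(** Lindelof: among the rational balls that meet [S] inside some good compact piece, choose
one piece for each. *)
Lemma countable_pieces : exists K : nat -> set 'rV[R]_n,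
  [/\ forall i, compact (K i), forall i, K i `<=` S,
      S = \bigcup_i K i,
      forall i, (sigma (K i) < +oo)%E &
      forall i, compact ((fun u => (u, N u)) @` K i)].
Proof.
pose good (c : 'rV[rat]_n * nat) (K : set 'rV[R]_n) :=
  [/\ rational_ball c `&` S `<=` K, K `<=` S &
   [/\ compact K, (sigma K < +oo)%E & compact ((fun u => (u, N u)) @` K)]].
pose K c := xget set0 (good c).
pose G i := if @choice.unpickle ('rV[rat]_n * nat)%type i is Some c then
  (if pselect (exists K, good c K) then K c else set0) else set0.
have GP i : G i `<=` S /\ [/\ compact (G i), (sigma (G i) < +oo)%E &
    compact ((fun u => (u, N u)) @` G i)].
  have h0 : set0 `<=` S /\ [/\ compact (set0 : set 'rV[R]_n), (sigma set0 < +oo)%E &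
    compact ((fun u => (u, N u)) @` set0)].
    split=> //; rewrite image_set0 measure0; split; exact: compact0 || exact: ltry.
  rewrite /G; case: choice.unpickle => [c|//]; case: pselect => // -[L gL].
  by have [_ LS hL] := xgetPex set0 (ex_intro _ _ gL).
exists G; split; try by move=> i; have [? []] := GP i.
apply/seteqP; split=> [p Sp|]; last by move=> p [i _]; have [+ _] := GP i; exact.
have [[U L] /= [oU Up UL LS hL]] := local_piece Sp.
have [c [cp cU]] := rational_ball_basis (open_nbhs_nbhs (conj oU Up)).
have gL : good c L by split=> // q [/cU Uq Sq]; exact: UL.
exists (choice.pickle c) => //; rewrite /G choice.pickleK; case: pselect => [gc|]; last first.
  by case; exists L.
by have [+ _ _] := xgetPex set0 gc; apply.
Qed.

Lemma compact_surface_fin C : compact C -> C `<=` S -> (sigma C < +oo)%E.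
Proof.
move=> cC CS.
have /choice[OK hOK] : forall p : 'rV[R]_n, exists OK : set 'rV[R]_n * set 'rV[R]_n,
    (sigma OK.2 < +oo)%E /\
    (S p -> [/\ open OK.1, OK.1 p, OK.1 `&` S `<=` OK.2 & compact OK.2]).
  move=> p; have [Sp|Sp] := pselect (S p).
    by have [OK [? ? ? ? [? ? ?]]] := local_piece Sp; exists OK.
  by exists (set0, set0); rewrite measure0; split.
move: (cC); rewrite compact_cover => /(_ _ C (fun p => (OK p).1))[||D DC CD].
- by move=> p /CS Sp; have [_ /(_ Sp)[]] := hOK p.
- by move=> p Cp; exists p => //; have [_ /(_ (CS _ Cp))[]] := hOK p.
have mC (A : set 'rV[R]_n) : compact A -> measurable (A : set (borelRV R n)).
  by move=> cA; apply: sigma_compact_measurableRV; exact: compact_sigma_compact.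
have DS p : p \in D -> S p by move=> /DC; rewrite inE => /CS.
apply: (@le_lt_trans _ _ (\sum_(p \in [set` D]) sigma (OK p).2)%E).
  apply: content_sub_fsum => //.
  - by move=> p /= /DS Sp; have [_ /(_ Sp)[_ _ _ cK]] := hOK p; exact: mC.
  - exact: mC.
  - move=> q Cq; have [p Dp Op] := CD _ Cq; exists p => //.
    by have [_ /(_ (DS _ Dp))[_ _ + _]] := hOK p; apply; split=> //; exact: CS.
rewrite fsbig_finite//=; last exact: finite_fset.
apply: (big_ind (fun x => (x < +oo)%E)) => [|x y|p _]; first exact: ltry.
  exact: lte_add_pinfty.
by have [] := hOK p.
Qed.

End pieces.

(** * First-order geometry of the hypersurface *)

Lemma normr_entry (R : realType) m n (A : 'M[R]_(m, n)) i j : `|A i j| <= `|A|.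
Proof.
by rewrite [leRHS]/Num.Def.normr/= mx_normrE; exact: (le_trans _ (le_bigmax _ _ (i, j))).
Qed.

Lemma normr_mx_le (R : realType) m n (A : 'M[R]_(m, n)) (c : R) :
  0 <= c -> (forall i j, `|A i j| <= c) -> `|A| <= c.
Proof.
move=> c0 h; rewrite [leLHS]/Num.Def.normr/= mx_normrE.
by apply/bigmax_leP; split => // -[i j] _; exact: h.
Qed.

Lemma normr_mulmx (R : realType) m p n (A : 'M[R]_(m, p)) (B : 'M[R]_(p, n)) :
  `|A *m B| <= p%:R * `|A| * `|B|.
Proof.
apply: normr_mx_le => [|i j]; first by rewrite !mulr_ge0.
rewrite mxE (le_trans (ler_norm_sum _ _ _))//.
apply: (@le_trans _ _ (\sum_(k < p) (`|A| * `|B|))).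
  by apply: ler_sum => k _; rewrite normrM ler_pM// normr_entry.
by rewrite sumr_const card_ord -mulrA mulr_natl.
Qed.

Section tangent.
Variables (R : realType) (n : nat) (S : set 'rV[R]_n) (N : 'rV[R]_n -> 'rV[R]_n).
Hypotheses (hS : smooth_hypersurface S) (hN : is_gauss_map S N).
Local Notation P := 'rV[R]_n.-1.

(** Points of [S] close to [phi y] come from parameters close to [y], as charts are
homeomorphisms onto relatively open parts of [S]. *)
Lemma chart_near V (phi : P -> 'rV[R]_n) (W : set P) (y : P) :
  is_chart S V phi -> V y -> nbhs y W ->
  \forall w \near within S (nbhs (phi y)), exists z, [/\ V z, W z & w = phi z].
Proof.
move=> hc Vy yW.
have oV' : open (W° `&` V) by apply: openI (chart_open hc); exact: open_interior.
have sV' : W° `&` V `<=` V by move=> z [].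
have [U oU UE] := chart_relopen hc oV' sV'.
have Uy : U (phi y).
  have : (phi @` (W° `&` V)) (phi y) by exists y.
  by rewrite UE => -[].
have nU : nbhs (phi y) U := open_nbhs_nbhs (conj oU Uy).
apply: (@filterS _ (nbhs (phi y)) _ U _ _ nU) => w Uw Sw.
have : (phi @` (W° `&` V)) w by rewrite UE.
by move=> [z [Wz Vz] <-]; exists z; split=> //; exact: interior_subset.
Qed.

Lemma jacobian_near m k (f : 'rV[R]_m -> 'rV[R]_k) y (e : R) :
  differentiable f y -> 0 < e ->
  \forall z \near y, `|f z - f y - (z - y) *m 'J f y| <= e * `|z - y|.
Proof.
move=> df e0; have /eqaddoP/(_ e e0)/nbhs_ballP[r /= r0 hr] := diff_locally df.
apply/nbhs_ballP; exists r => //= z yz.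
have hz : ball (0 : 'rV[R]_m) r (z - y).
  by move: yz; rewrite -!ball_normE /ball_/= sub0r normrN distrC.
have := hr _ hz.
rewrite -[X in `|X| <= _]/(f (z - y + y) - (f y + 'd f y (z - y))).
by rewrite subrK opprD addrA /jacobian mul_rV_lin1.
Qed.

(** A right inverse of [J] recovers [h] from [h *m J]. *)
Lemma row_free_normr m k (J : 'M[R]_(m, k)) : row_free J ->
  exists2 c : R, 0 < c & forall h : 'rV_m, `|h| <= c * `|h *m J|.
Proof.
move=> /row_freeP[B JB]; exists (k%:R * `|B| + 1) => [|h].
  by rewrite ltr_wpDl// mulr_ge0.
rewrite -{1}[h]mulmx1 -JB mulmxA (le_trans (normr_mulmx _ _))//.
by rewrite mulrAC ler_wpM2r// lerDl.
Qed.

(** The remainder of the first-order expansion of [phi] is small relative to the parameter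
increment, which is itself controlled by the secant since [phi] is an immersion. *)
Lemma chart_secant V (phi : P -> 'rV[R]_n) (y : P) :
  is_chart S V phi -> V y ->
  forall e, 0 < e ->
    \forall w \near within S (nbhs (phi y)), exists h : P,
      `|w - phi y - h *m 'J phi y| <= e * `|w - phi y|.
Proof.
move=> hc Vy e e0; have [c c0 hJ] := row_free_normr (chart_immersion hc Vy).
(* The second bound on [e'] absorbs the remainder and gives [`|z - y| <= 2 c `|phi z - phi y|],
   the first one turns this into the required precision. *)
pose e' := Num.min (e / (2 * c)) ((2 * c)^-1).
have e'0 : 0 < e' by rewrite lt_min divr_gt0 ?invr_gt0 ?mulr_gt0.
have e'1 : c * e' <= 2^-1.
  rewrite mulrC -ler_pdivlMr//; apply: (@le_trans _ _ ((2 * c)^-1)).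
    by rewrite ge_min lexx orbT.
  by rewrite invfM.
have e'2 : e' * (2 * c) <= e.
  by rewrite -ler_pdivlMr ?mulr_gt0// ge_min lexx.
have := chart_near hc Vy (jacobian_near (chart_differentiable hc Vy) e'0).
apply: filterS => _ [z [Vz hz ->]]; exists (z - y).
have h1 : `|z - y| <= c * (`|phi z - phi y| + e' * `|z - y|).
  apply: le_trans (hJ _) _; rewrite ler_pM2l//.
  rewrite -[X in `|X| <= _](subKr (phi z - phi y)) (le_trans (ler_normB _ _))//.
  by rewrite lerD2l.
have h2 : (c * e') * `|z - y| <= 2^-1 * `|z - y| by rewrite ler_wpM2r.
have h3 : `|z - y| <= 2 * c * `|phi z - phi y| by nra.
apply: le_trans hz _; apply: (@le_trans _ _ (e' * (2 * c * `|phi z - phi y|))).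
  by rewrite ler_pM2l.
by rewrite mulrA ler_wpM2r.
Qed.

(** Apply the estimate to the secants towards [phi (y + t h)] and let [t] tend to [0]; the
error [s] below is the precision of the expansion of [phi] that makes the total error
at most [d]. *)
Lemma chart_detect V (phi : P -> 'rV[R]_n) (y : P) (A : 'M[R]_n) (e : R) :
  is_chart S V phi -> V y -> 0 <= e ->
  (\forall w \near within S (nbhs (phi y)), `|(w - phi y) *m A| <= e * `|w - phi y|) ->
  forall h : P, `|h *m 'J phi y *m A| <= e * `|h *m 'J phi y|.
Proof.
move=> hc Vy e0 hA h; apply/ler_addgt0Pr => d d0.
pose K := `|h| * (e + n%:R * `|A|).
have K0 : 0 <= K by rewrite mulr_ge0// addr_ge0// mulr_ge0.
pose s := d / (K + 1).
have K1 : 0 < K + 1 by rewrite ltr_wpDl.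
have s0 : 0 < s by rewrite divr_gt0.
have nV : nbhs y V := open_nbhs_nbhs (conj (chart_open hc) Vy).
have nA : nbhs y (phi @^-1` [set w | S w -> `|(w - phi y) *m A| <= e * `|w - phi y|]).
  exact: (chart_continuous hc Vy hA).
have nJ := jacobian_near (chart_differentiable hc Vy) s0.
have [r /= r0 hr] := (nbhs_ballP _ _).1 (filterI nV (filterI nA nJ)).
(* The denominator is [`|h| + 1] and not [`|h|] to cover [h = 0]. *)
pose t := r / 2 / (`|h| + 1).
have h10 : 0 < `|h| + 1 by rewrite ltr_wpDl.
have t0 : 0 < t by rewrite !divr_gt0.
have th : t * (`|h| + 1) = r / 2 by rewrite divfK ?gt_eqF.
have yt : ball y r (t *: h + y).
  rewrite -ball_normE /ball_/= opprD addrC subrK normrN normrZ gtr0_norm//.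
  by rewrite mulrDr mulr1 in th; lra.
have [Vz [/= + hz]] := hr _ yt.
have Sz : S (phi (t *: h + y)) by apply: (chart_sub hc); exists (t *: h + y).
move=> /(_ Sz); rewrite addrK normrZ (gtr0_norm t0) -scalemxAl in hz *.
move: (phi _ - _) hz => w hw hwA.
have hw' : `|w| <= t * `|h *m 'J phi y| + s * (t * `|h|).
  rewrite -[w](subrK (t *: (h *m 'J phi y))) (le_trans (ler_normD _ _))//.
  by rewrite addrC normrZ gtr0_norm// lerD.
have hA1 : t * `|h *m 'J phi y *m A| <= `|w *m A| + n%:R * (s * (t * `|h|)) * `|A|.
  rewrite -{1}(gtr0_norm t0) -normrZ scalemxAl.
  have -> : (t *: (h *m 'J phi y)) *m A =
      w *m A - (w - t *: (h *m 'J phi y)) *m A by rewrite mulmxBl subKr.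
  rewrite (le_trans (ler_normB _ _))// lerD2l.
  by rewrite (le_trans (normr_mulmx _ _))// ler_wpM2r// ler_wpM2l.
have sK : s * K <= d.
  by rewrite /s mulrAC ler_pdivrMr// ler_pM2l// lerDl.
rewrite -(ler_pM2l t0); apply: le_trans hA1 _.
have h3 : e * `|w| <= e * (t * `|h *m 'J phi y| + s * (t * `|h|)) by rewrite ler_wpM2l.
have h4 : t * (s * K) <= t * d by rewrite ler_pM2l.
have h5 : t * (s * K) = e * (s * (t * `|h|)) + n%:R * (s * (t * `|h|)) * `|A|.
  by rewrite /K; ring.
rewrite h5 in h4; lra.
Qed.

(** The rows of ['J phi y] and the unit normal, which is orthogonal to them, form a basis
of the ambient space. *)
Lemma gauss_frame_left_inverse V (phi : P -> 'rV[R]_n) (y : P) :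
  (0 < n)%N -> is_chart S V phi -> V y ->
  exists Q, Q *m col_mx ('J phi y) (N (phi y)) = 1%:M.
Proof.
move=> n0 hc Vy; apply/row_fullP.
have Su : S (phi y) by apply: (chart_sub hc); exists y.
have NN : N (phi y) *m (N (phi y))^T = 1%:M.
  by rewrite [LHS]mx11_scalar -/(dot _ _) (gauss_unit hN Su).
have JN := gauss_normal hN hc Vy.
have : row_free (col_mx ('J phi y) (N (phi y))).
  apply/row_freeP; case/row_freeP: (chart_immersion hc Vy) => B JB.
  exists (row_mx (B - (N (phi y))^T *m (N (phi y) *m B)) (N (phi y))^T).
  rewrite mul_col_row !mulmxBr JB !mulmxA JN NN !mul0mx subr0 mul1mx subrr.
  by rewrite -scalar_mx_block.
by rewrite /row_free /row_full => /eqP ->; rewrite addn1 prednK.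
Qed.

(** A matrix is determined by its values on the tangent vectors, which are seen by secants
of [S], and on the normal vector.  The constant depends on [u] alone; this gives both the
uniqueness of the differential and the convergence of its approximations. *)
Lemma tangent_detect u : (0 < n)%N -> S u ->
  exists2 C : R, 0 <= C & forall (A : 'M[R]_n) e, 0 <= e ->
    (\forall w \near within S (nbhs u), `|(w - u) *m A| <= e * `|w - u|) ->
    `|A| <= C * (e + `|N u *m A|).
Proof.
move=> n0 Su; have [V [phi [hc [y Vy yu]]]] := hS Su; subst u.
have [Q hQ] := gauss_frame_left_inverse n0 hc Vy.
pose k : R := (n.-1 + 1)%:R.
exists (k * `|Q| * (`|'J phi y| + 1)) => [|A e e0 hA].
  by rewrite !mulr_ge0// addr_ge0.
have {}hA : forall h : P, `|h *m 'J phi y *m A| <= e * `|h *m 'J phi y|.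
  exact: (chart_detect hc Vy e0 hA).
have hJA : `|'J phi y *m A| <= e * `|'J phi y|.
  apply: normr_mx_le => [|i j]; first by rewrite mulr_ge0.
  have -> : ('J phi y *m A) i j = ((delta_mx 0 i : 'rV_n.-1) *m 'J phi y *m A) 0 j.
    by rewrite -mulmxA -rowE [RHS]mxE.
  apply: le_trans (normr_entry _ _ _) _; apply: le_trans (hA _) _.
  rewrite ler_wpM2l// -rowE; apply: normr_mx_le => // a b.
  by rewrite [X in `|X|]mxE normr_entry.
rewrite -{1}[A]mul1mx -hQ -mulmxA mul_col_mx.
apply: le_trans (normr_mulmx _ _) _; rewrite -/k -[leRHS]mulrA ler_wpM2l ?mulr_ge0//.
apply: normr_mx_le => [|i j].
  by rewrite mulr_ge0 ?addr_ge0.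
rewrite [X in `|X|]mxE; case: fintype.split => {i} i.
  apply: le_trans (normr_entry _ _ _) _; apply: le_trans hJA _.
  have := normr_ge0 ('J phi y); have := normr_ge0 (N (phi y) *m A); nra.
apply: le_trans (normr_entry _ _ _) _.
have := normr_ge0 ('J phi y); have := normr_ge0 (N (phi y) *m A); nra.
Qed.

Lemma secant_normal u e : S u -> 0 < e ->
  \forall w \near within S (nbhs u), `|(w - u) *m (N u)^T| <= e * `|w - u|.
Proof.
move=> Su e0; have [V [phi [hc [y Vy yu]]]] := hS Su; subst u.
have K0 : 0 < n%:R * `|(N (phi y))^T| + 1 by rewrite ltr_wpDl// mulr_ge0.
have := chart_secant hc Vy (divr_gt0 e0 K0).
apply: filterS => w [h hw].
have -> : (w - phi y) *m (N (phi y))^T =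
    (w - phi y - h *m 'J phi y) *m (N (phi y))^T.
  by rewrite [RHS]mulmxBl -(mulmxA h) (gauss_normal hN hc Vy) mulmx0 subr0.
apply: le_trans (normr_mulmx _ _) _.
rewrite mulrAC; apply: (@le_trans _ _ ((n%:R * `|(N (phi y))^T| + 1) *
   (e / (n%:R * `|(N (phi y))^T| + 1) * `|w - phi y|))).
  by apply: ler_pM => //; rewrite ?mulr_ge0// lerDl.
by rewrite mulrA mulrCA divff ?gt_eqF// mulr1.
Qed.

(** Correcting a differential by its value on the normal vector leaves it a differential,
since secants have a negligible normal component. *)
Lemma tderivP (D : set 'rV[R]_n) F u : S u -> tdifferentiable S D F u ->
  is_tderiv S D F u (tderiv S N D F u) /\ N u *m tderiv S N D F u = 0.
Proof.
move=> Su [L [hD hL]].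
have NN : N u *m (N u)^T = 1%:M.
  by rewrite [LHS]mx11_scalar -/(dot _ _) (gauss_unit hN Su).
pose L' := L - (N u)^T *m (N u *m L).
apply: (@getPex _ [set L | is_tderiv S D F u L /\ N u *m L = 0]); exists L'.
split; last by rewrite /L' mulmxBr (mulmxA (N u) (N u)^T) NN mul1mx subrr.
split=> // e e0.
have e20 : 0 < e / 2 by rewrite divr_gt0.
have K0 : 0 < `|N u *m L| + 1 by rewrite ltr_wpDl.
apply: (filterS2 _ _ (hL _ e20) (secant_normal Su (divr_gt0 e20 K0))).
move=> w h1 h2.
rewrite mulmxBr opprB addrCA [X in `|X|]addrC [e]splitr mulrDl.
apply: le_trans (ler_normD _ _) _; rewrite lerD// (mulmxA (w - u)).
apply: le_trans (normr_mulmx _ _) _; rewrite mul1r.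
apply: (@le_trans _ _ ((e / 2 / (`|N u *m L| + 1) * `|w - u|) * (`|N u *m L| + 1))).
  by apply: ler_pM => //; rewrite lerDl.
by rewrite mulrAC divfK ?gt_eqF.
Qed.

End tangent.

(** * Continuity of matrix expressions *)

Section continuity.
Context {R : realType} {T : topologicalType}.

Lemma continuous_fst_comp (U V : topologicalType) (f : T -> U * V) :
  continuous f -> continuous (fun t => (f t).1).
Proof. by move=> cf t; apply: (cvg_comp _ _ (cf t)); exact: cvg_fst. Qed.

Lemma continuous_snd_comp (U V : topologicalType) (f : T -> U * V) :
  continuous f -> continuous (fun t => (f t).2).
Proof. by move=> cf t; apply: (cvg_comp _ _ (cf t)); exact: cvg_snd. Qed.

Lemma continuous_pair_comp (U V : topologicalType) (f : T -> U) (g : T -> V) :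
  continuous f -> continuous g -> continuous (fun t => (f t, g t)).
Proof. by move=> cf cg t; exact: (cvg_pair (cf t) (cg t)). Qed.

Lemma continuous_entry m n (f : T -> 'M[R]_(m, n)) i j :
  continuous f -> continuous (fun t => f t i j).
Proof. by move=> cf t; exact: (continuous_comp (cf t) (@coord_continuous R m n i j (f t))). Qed.

Lemma continuous_col_mx m1 m2 n (f : T -> 'M[R]_(m1, n)) (g : T -> 'M[R]_(m2, n)) :
  (forall i j, continuous (fun t => f t i j)) ->
  (forall i j, continuous (fun t => g t i j)) ->
  forall i j, continuous (fun t => col_mx (f t) (g t) i j).
Proof.
move=> cf cg i j.
have -> : (fun t => col_mx (f t) (g t) i j) =
    match fintype.split i with inl i1 => fun t => f t i1 j | inr i2 => fun t => g t i2 j end.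
  by apply/funext => t; rewrite mxE; case: fintype.split.
by case: fintype.split.
Qed.

Lemma closed_eq0 (f : T -> R) : continuous f -> closed [set t | f t = 0].
Proof.
move=> cf; apply: (@closed_comp _ _ f [set y | y = 0]) => //; exact: closed_eq.
Qed.

Lemma closed_ge0 (f : T -> R) : continuous f -> closed [set t | 0 <= f t].
Proof.
move=> cf; apply: (@closed_comp _ _ f [set y | 0 <= y]) => //; exact: closed_ge.
Qed.

Lemma continuous_dot n (f g : T -> 'rV[R]_n) :
  continuous f -> continuous g -> continuous (fun t => dot (f t) (g t)).
Proof.
move=> cf cg t; apply: cvg_mulmx => i j; first exact: continuous_entry.
rewrite mxE; under eq_cvg do rewrite mxE.
exact: continuous_entry.
Qed.

Lemma continuous_norm_comp (V : normedModType R) (f : T -> V) :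
  continuous f -> continuous (fun t => `|f t|).
Proof. by move=> cf t; exact: (continuous_comp (cf t) (@norm_continuous _ _ (f t))). Qed.

Lemma continuous_subr (V : normedModType R) (f g : T -> V) :
  continuous f -> continuous g -> continuous (fun t => f t - g t).
Proof. by move=> cf cg t; exact: (cvgB (cf t) (cg t)). Qed.

Lemma mulmxr_continuous m n (A : 'M[R]_(m, n)) :
  continuous (fun v : 'rV[R]_m => v *m A).
Proof.
apply: (linear_bounded_continuous (mulmxr A)).1.
apply/linear_boundedP; near=> r => v /=.
rewrite (le_trans (normr_mulmx _ _))// mulrAC ler_wpM2r//.
Unshelve. all: by end_near. Qed.

Lemma continuous_mulmxr_comp m n (A : 'M[R]_(m, n)) (f : T -> 'rV[R]_m) :
  continuous f -> continuous (fun t => f t *m A).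
Proof.
by move=> cf t; exact: (continuous_comp (cf t) (@mulmxr_continuous _ _ A (f t))).
Qed.

(** A vector killed by the Gram matrix on the left gives a combination of the rows of [A]
of length [0]. *)
Lemma row_free_gram m n (A : 'M[R]_(m, n)) :
  row_free A = (\det (A *m A^T) != 0).
Proof.
rewrite -unitfE -unitmxE -row_free_unit; apply/idP/idP => [fA|/row_freeP[B]].
  apply: inj_row_free => v vA; apply: (row_free_inj fA); rewrite mul0mx.
  have : dot (v *m A) (v *m A) = 0.
    by rewrite /dot trmx_mul !mulmxA -(mulmxA v) vA mul0mx mxE.
  rewrite /dot mxE => h; apply/rowP => j; rewrite [RHS]mxE.
  have {}h : \sum_k (v *m A) 0 k ^+ 2 = 0.
    by rewrite -[RHS]h; apply: eq_bigr => k _; rewrite [(v *m A)^T _ _]mxE expr2.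
  have := psumr_eq0P (fun k _ => sqr_ge0 ((v *m A) 0 k)) h.
  by move=> /(_ j isT)/eqP; rewrite sqrf_eq0 => /eqP.
by rewrite -mulmxA => AB; apply/row_freeP; exists (A^T *m B).
Qed.

(** Linear dependence of three vectors is the vanishing of their Gram determinant. *)
Lemma closed_rank_lt3 n (f g h : T -> 'rV[R]_n) :
  continuous f -> continuous g -> continuous h ->
  closed [set t | (\rank (col_mx (f t) (col_mx (g t) (h t))) < 3)%N].
Proof.
move=> cf cg ch; pose A t := col_mx (f t) (col_mx (g t) (h t)).
have cA i j : continuous (fun t => A t i j).
  apply: continuous_col_mx => {i j} i j; first exact: continuous_entry.
  by apply: continuous_col_mx => {i j} i j; exact: continuous_entry.
have -> : [set t | (\rank (col_mx (f t) (col_mx (g t) (h t))) < 3)%N] =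
    [set t | \det (A t *m (A t)^T) = 0].
  apply/seteqP; split => t /=; rewrite -/(A t).
    move=> rA; apply/eqP; rewrite -[_ == _]negbK -row_free_gram.
    by rewrite /row_free neq_ltn rA.
  move/eqP; rewrite -[_ == _]negbK -row_free_gram /row_free => rA.
  by have := rank_leq_row (A t); rewrite leq_eqVlt (negbTE rA).
apply: closed_eq0 => t; apply: cvg_det; apply: cvg_mulmx => i j; first exact: cA.
rewrite mxE; under eq_cvg do rewrite mxE.
exact: cA.
Qed.

End continuity.

(** * Borel measurability of the map R *)

Lemma continuous_idfun (T : topologicalType) : continuous (fun t : T => t).
Proof. by move=> t; exact: cvg_id. Qed.

Ltac prove_continuous := repeat lazymatch goal with
  | |- continuous (fun t => dot (@?f t) (@?g t)) => apply: continuous_dot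
  | |- continuous (fun t => @?f t *m ?A) => apply: continuous_mulmxr_comp
  | |- continuous (fun t => `|@?f t|) => apply: continuous_norm_comp
  | |- continuous (fun t => @?f t - @?g t) => apply: continuous_subr
  | |- continuous (fun t => (@?f t, @?g t)) => apply: continuous_pair_comp
  | |- continuous (fun t => (@?f t).1) => apply: continuous_fst_comp
  | |- continuous (fun t => (@?f t).2) => apply: continuous_snd_comp
  | |- continuous fst => by move=> ?; exact: cvg_fst
  | |- continuous snd => by move=> ?; exact: cvg_snd
  | |- continuous (fun t => t) => exact: continuous_idfun
  | |- continuous (fun=> _) => exact: cst_continuous
  end.

Section reflection_map.
Variables (R : realType) (n : nat) (S : set 'rV[R]_n) (N : 'rV[R]_n -> 'rV[R]_n).
Local Notation E := 'rV[R]_n.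
Local Notation T := (borelRV R n).
Hypothesis NS_sigma_compact : sigma_compact ((fun u => (u, N u)) @` S).

Definition Rgraph : set (E * E * E) :=
  [set t | [/\ S t.1.1, S t.1.2 & Rrel S N t.1.1 t.1.2 t.2]].

(** The normals are carried along as additional coordinates in the graph of [N]; in terms of
points and normals, all defining conditions are closed except [u'' <> u'], and the graph
of the relation is recovered by forgetting the normals. *)
Lemma Rgraph_sigma_compact : sigma_compact Rgraph.
Proof.
pose G := (fun u => (u, N u)) @` S.
pose Z := ((((G `*` G) `*` G) `&` [set p | dot (p.1.2.1 - p.2.1) p.1.1.2 = 0])
  `&` [set p | (\rank (col_mx p.1.1.2 (col_mx p.1.2.2 p.2.2)) < 3)%N])
  `&` [set p | 0 < `|p.2.1 - p.1.2.1|].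
have -> : Rgraph = (fun p => (p.1.1.1, p.1.2.1, p.2.1)) @` Z.
  apply/seteqP; split => [[[u u'] u''] [/= Su Su' [Su'' u'u'' d r]]|].
    exists (((u, N u), (u', N u')), (u'', N u'')) => //; split; last first.
      by rewrite /= normr_gt0 subr_eq0; apply/eqP.
    by split=> //; split=> //; split; [split|]; [exists u|exists u'|exists u''].
  move=> _ [[[[u nu] [u' nu']] [u'' nu'']] [[[[[/= Gu Gu'] Gu''] d] r] ne] <-].
  case: Gu Gu' Gu'' => v Sv [? ?] [v' Sv' [? ?]] [v'' Sv'' [? ?]]; subst.
  split=> //=; split=> //.
  by move=> e; move: ne; rewrite /= e subrr normr0 ltxx.
apply: sigma_compact_image; first by prove_continuous.
apply: sigma_compactI_gt0; first by prove_continuous.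
apply: sigma_compactI_closed; last by apply: closed_rank_lt3; prove_continuous.
apply: sigma_compactI_closed; last by apply: closed_eq0; prove_continuous.
by do 2 apply: sigma_compact_setX => //.
Qed.

(** The diagonal is excluded: there the Jacobian is not controlled. *)
Definition Rdom : set (E * E) :=
  [set z | [/\ S z.1, S z.2, z.1 <> z.2 & exists! c, Rrel S N z.1 z.2 c]].

Lemma Rmap_rel z : Rdom z -> Rrel S N z.1 z.2 (Rmap S N z.1 z.2).
Proof.
case: z => u u' [/= Su Su' uu' [c [hc _]]]; rewrite /Rmap; case: eqP => // _.
exact: (xgetPex u' (ex_intro _ c hc)).
Qed.

Lemma Rmap_uniq z c : Rdom z -> Rrel S N z.1 z.2 c -> c = Rmap S N z.1 z.2.
Proof.
move=> Dz hc; have [_ _ _ [d [_ hd]]] := Dz.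
by rewrite -(hd _ hc); apply: hd; exact: Rmap_rel.
Qed.

(** Existence of [u''] is a projection of the graph ([A1]), and failure of uniqueness a
projection of pairs of distinct points of the graph over the same base point ([A2]). *)
Lemma measurable_Rdom : measurable (Rdom : set (T * T)).
Proof.
have sG := Rgraph_sigma_compact.
pose A1 : set (E * E) := (fun t => t.1) @` Rgraph.
pose A2 : set (E * E) := (fun p => p.1.1) @`
  (((Rgraph `*` Rgraph) `&` [set p | `|p.1.1.1 - p.2.1.1| = 0]) `&`
    [set p | `|p.1.1.2 - p.2.1.2| = 0] `&` [set p | 0 < `|p.1.2 - p.2.2|]).
pose A3 : set (E * E) := [set z | `|z.1 - z.2| = 0].
have A2E z : A2 z <-> exists c d, [/\ Rgraph (z, c), Rgraph (z, d) & c <> d].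
  split; last first.
    move=> [c [d [hc hd cd]]]; exists ((z, c), (z, d)) => //=.
    by rewrite !subrr !normr0 normr_gt0 subr_eq0; do !split=> //; exact/eqP.
  move=> [[[[u u'] c] [[v v'] d]] [[[[/= hc hd] e] e'] cd] <-] /=.
  move/normr0_eq0/eqP: e; move/normr0_eq0/eqP: e'; rewrite !subr_eq0.
  move=> /eqP ? /eqP ?; subst; exists c, d; split=> // e.
  by move: cd; rewrite e subrr normr0 ltxx.
have DE : Rdom = (A1 `\` A2) `\` A3.
  apply/seteqP; split => [[u u'] [/= Su Su' uu' [c [hc hu]]]|].
    split.
      split; first by exists (u, u', c).
      move=> /A2E[a [b [[_ _ /= ha] [_ _ /= hb] ab]]]; apply: ab.
      by rewrite -(hu _ ha); exact: hu.
    by move=> /normr0_eq0/eqP; rewrite subr_eq0 => /eqP; exact: uu'.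
  move=> [u u'] [[[[[v v'] c] [Su Su' hc] /= [? ?]] nA2] uu']; subst.
  split=> //=; first by move=> e; apply: uu'; rewrite /A3/= e subrr normr0.
  exists c; split=> // d hd; apply/eqP/negP => /negP/eqP cd.
  by apply: nA2; apply/A2E; exists c, d.
rewrite DE; apply: measurableD; first apply: measurableD.
- apply: sigma_compact_measurableRV2; apply: sigma_compact_image => //.
  by prove_continuous.
- apply: sigma_compact_measurableRV2; apply: sigma_compact_image.
    by prove_continuous.
  apply: sigma_compactI_gt0; first by prove_continuous.
  apply: sigma_compactI_closed; last by apply: closed_eq0; prove_continuous.
  apply: sigma_compactI_closed; last by apply: closed_eq0; prove_continuous.
  exact: sigma_compact_setX.
- rewrite -[A3]setCK; apply: measurableC; apply: measurable_openRV2.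
  by apply: closed_openC; apply: closed_eq0; prove_continuous.
Qed.

(** By uniqueness, [R_u u'] avoids a closed set exactly when no point of the graph over
[(u, u')] lies in it. *)
Lemma measurable_Rmap :
  measurable_fun (Rdom : set (T * T)) (fun z => Rmap S N z.1 z.2 : T).
Proof.
apply: (@measurability _ _ (T * T)%type T _ _ (@open E)) => //.
move=> _ [U oU <-].
pose F : set (E * E) := (fun t => t.1) @` (Rgraph `&` [set t | (~` U) t.2]).
have -> : Rdom `&` (fun z => Rmap S N z.1 z.2) @^-1` U = Rdom `\` F.
  apply/seteqP; split => z [Dz hz]; split=> //.
    move=> [[t c] [[_ _ /= hc] nUc] /= tz]; subst.
    by apply: nUc; rewrite (Rmap_uniq Dz hc).
  apply: contrapT => nU; apply: hz; exists (z, Rmap S N z.1 z.2) => //.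
  by split=> //; have [Su Su' _ _] := Dz; split=> //; exact: Rmap_rel.
apply: measurableD; first exact: measurable_Rdom.
apply: sigma_compact_measurableRV2; apply: sigma_compact_image.
  by prove_continuous.
apply: sigma_compactI_closed; first exact: Rgraph_sigma_compact.
apply: (@closed_comp _ _ (fun t : E * E * E => t.2) (~` U)).
  by move=> t _; exact: cvg_snd.
exact: open_closedC.
Qed.

End reflection_map.

(** * The differential of R through countably many conditions *)

Lemma rat_mx_approx (R : realType) m n (A : 'M[R]_(m, n)) (e : R) : 0 < e ->
  exists k : 'M[rat]_(m, n), `|map_mx ratr k - A| <= e.
Proof.
move=> e0.
have hq (ij : 'I_m * 'I_n) : exists q : rat, `|ratr q - A ij.1 ij.2| <= e.
  have [|q] := @rat_in_itvoo R (A ij.1 ij.2 - e) (A ij.1 ij.2 + e).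
    by rewrite ltrBlDr -addrA ltrDl addr_gt0.
  rewrite in_itv/= => /andP[h1 h2]; exists q.
  by rewrite ler_distl !ltW.
have [q Hq] := choice hq.
exists (\matrix_(i, j) q (i, j)); apply: normr_mx_le => [|i j]; first exact: ltW.
by rewrite !mxE; exact: (Hq (i, j)).
Qed.

Lemma continuous_mulr_cst (R : realType) (T : topologicalType) (c : R) (f : T -> R) :
  continuous f -> continuous (fun t => c * f t).
Proof. by move=> cf t; apply: cvgM; [exact: cvg_cst|exact: cf]. Qed.

Lemma within_radius (R : realType) (V : normedModType R) (S P : set V) (u : V) :
  (\forall w \near within S (nbhs u), P w) ->
  exists d : nat, forall w, S w -> `|w - u| <= d.+1%:R^-1 -> P w.
Proof.
move=> /nbhs_ballP[r /= r0 hr].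
have [d hd] := ltr_add_invr r0; rewrite add0r in hd.
exists d => w Sw wu; apply: hr => //.
by rewrite -ball_normE /ball_/= distrC (le_lt_trans wu).
Qed.

Section jacobian.
Variables (R : realType) (n : nat) (S : set 'rV[R]_n) (N : 'rV[R]_n -> 'rV[R]_n).
Local Notation E := 'rV[R]_n.
Local Notation T := (borelRV R n).
Hypothesis n0 : (0 < n)%N.
Hypotheses (hS : smooth_hypersurface S) (hN : is_gauss_map S N).
Hypothesis NS_sigma_compact : sigma_compact ((fun u => (u, N u)) @` S).
Hypothesis Rdiff : forall u u', Rdom1 S N u' u -> S u' -> u <> u' ->
  tdifferentiable S (Rdom1 S N u') (Rmap S N ^~ u') u.

Let L (z : E * E) := tderiv S N (Rdom1 S N z.2) (Rmap S N ^~ z.2) z.1.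

Lemma Rdom_tderiv z : Rdom S N z ->
  is_tderiv S (Rdom1 S N z.2) (Rmap S N ^~ z.2) z.1 (L z) /\ N z.1 *m L z = 0.
Proof.
move=> [Su Su' uu' hex]; apply: tderivP => //.
by apply: Rdiff => //; split=> //; right.
Qed.

(** Existence of a differential includes that [R] is defined at the nearby points of [S]. *)
Lemma Rdom_near z : Rdom S N z ->
  \forall w \near within S (nbhs z.1), Rdom S N (w, z.2).
Proof.
move=> Dz; have [[h _] _] := Rdom_tderiv Dz; have [_ Su' uu' _] := Dz.
have h2 : \forall w \near within S (nbhs z.1), w <> z.2.
  apply/nbhs_ballP; exists `|z.1 - z.2| => /=.
    by rewrite normr_gt0 subr_eq0; apply/eqP.
  by move=> w /[swap] _; rewrite -ball_normE /ball_/= => + e; rewrite e ltxx.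
apply: (filterS2 _ _ h h2) => w [Sw [//|hex]] wu'.
by split.
Qed.

(** The points where the secant estimate for the candidate differential [k], at precision [e]
and within radius [d], fails.  It is expressed with the graph of the relation and not
with the function [R], because only the former is known to be sigma-compact. *)
Definition bad_secant (e d : R) (k : 'M[R]_n) : set (E * E) :=
  [set z | exists w a b, [/\ Rgraph S N (z, a), Rgraph S N ((w, z.2), b),
     `|w - z.1| <= d & e * `|w - z.1| < `|b - a - (w - z.1) *m k| ]].

Lemma bad_secant_sigma_compact e d k : sigma_compact (bad_secant e d k).
Proof.
have sG := Rgraph_sigma_compact NS_sigma_compact.
pose Z := (((Rgraph S N `*` Rgraph S N) `&` [set p | `|p.1.1.2 - p.2.1.2| = 0]) `&`
  [set p | 0 <= d - `|p.2.1.1 - p.1.1.1| ]) `&`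
  [set p | 0 < `|p.2.2 - p.1.2 - (p.2.1.1 - p.1.1.1) *m k| - e * `|p.2.1.1 - p.1.1.1| ].
have -> : bad_secant e d k = (fun p => p.1.1) @` Z.
  apply/seteqP; split => [[u u'] [w [a [b [/= ha hb hd he]]]]|].
    exists ((u, u', a), (w, u', b)) => //.
    by do !split => //=; rewrite ?subrr ?normr0 ?subr_ge0 ?subr_gt0.
  move=> _ [[[[u u'] a] [[w u2] b]] [[[[/= ha hb] e1] hd] he] <-] /=.
  move: e1 hd he => /normr0_eq0/eqP /=; rewrite subr_eq0 => /eqP ?; subst.
  rewrite subr_ge0 subr_gt0 => hd he.
  by exists w, a, b.
apply: sigma_compact_image; first by prove_continuous.
apply: sigma_compactI_gt0.
  by apply: continuous_subr; [|apply: continuous_mulr_cst]; prove_continuous.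
apply: sigma_compactI_closed; last by apply: closed_ge0; prove_continuous.
apply: sigma_compactI_closed; last by apply: closed_eq0; prove_continuous.
exact: sigma_compact_setX.
Qed.

Lemma not_bad_secantP z e d k : Rdom S N z -> ~ bad_secant e d k z ->
  forall w, S w -> Rdom S N (w, z.2) -> `|w - z.1| <= d ->
    `|Rmap S N w z.2 - Rmap S N z.1 z.2 - (w - z.1) *m k| <= e * `|w - z.1|.
Proof.
move=> Dz nB w Sw Dw wd; rewrite leNgt; apply/negP => h; apply: nB.
exists w, (Rmap S N z.1 z.2), (Rmap S N w z.2).
have [Su Su' _ _] := Dz.
by split=> //; split=> //; [exact: Rmap_rel|exact: (Rmap_rel Dw)].
Qed.

Lemma bad_secantN z e d k : Rdom S N z ->
  (forall w, S w -> `|w - z.1| <= d -> Rdom S N (w, z.2) /\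
    `|Rmap S N w z.2 - Rmap S N z.1 z.2 - (w - z.1) *m k| <= e * `|w - z.1|) ->
  ~ bad_secant e d k z.
Proof.
move=> Dz h [w [a [b [[_ _ /= ha] [/= Sw _ hb] wd]]]].
have [Dw hw] := h _ Sw wd.
by rewrite (Rmap_uniq Dz ha) (Rmap_uniq Dw hb) ltNge hw.
Qed.

(** Only countably many conditions, each of them Borel in [z], occur on the right.  From left
to right, a rational matrix close enough to the differential satisfies the
secant estimate at precision [1 / (m + 1)].  Conversely, the difference between a matrix
that satisfies it and the differential is small on secants and on the normal vector,
hence at most [3 C / (m + 1)] by [tangent_detect]. *)
Lemma tderiv_entry_le z i j (c : R) : Rdom S N z ->
  L z i j <= c <->
  forall m : nat, exists p : 'M[rat]_n * nat,
    [/\ ratr (p.1 i j) <= c + m.+1%:R^-1,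
        ~ bad_secant m.+1%:R^-1 p.2.+1%:R^-1 (map_mx ratr p.1) z &
        `|N z.1 *m map_mx ratr p.1| <= m.+1%:R^-1].
Proof.
move=> Dz; have [[_ hL] NL] := Rdom_tderiv Dz.
have [Su Su' uu' _] := Dz.
split=> [Lc m|h].
  set e := m.+1%:R^-1; have e0 : 0 < e :> R by rewrite invr_gt0.
  (* A matrix within [s] of the differential changes the secant estimate by at most [e / 2]
     and has a value of norm at most [e] on the normal vector. *)
  pose K := n%:R * (`|N z.1| + 1) + 1 : R.
  have K1 : 1 <= K by rewrite lerDr mulr_ge0 ?addr_ge0.
  have K0 : 0 < K by rewrite (lt_le_trans ltr01).
  pose s := e / 2 / K; have s0 : 0 < s by rewrite !divr_gt0.
  have sK : s * K = e / 2 by rewrite divfK ?gt_eqF.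
  have [k hk] := rat_mx_approx (L z) s0.
  have e20 : 0 < e / 2 by rewrite divr_gt0.
  have [d hd] := within_radius (filterI (Rdom_near Dz) (hL _ e20)).
  exists (k, d); split => /=.
  - have := normr_entry (map_mx ratr k - L z) i j; rewrite !mxE ler_norml.
    move=> /andP[_ h]; have se : s <= e.
      have : s * 1 <= s * K by rewrite ler_pM2l.
      by rewrite sK mulr1; lra.
    lra.
  - apply: bad_secantN => // w Sw wd; have [Dw hw] := hd _ Sw wd; split=> //.
    have -> : Rmap S N w z.2 - Rmap S N z.1 z.2 - (w - z.1) *m map_mx ratr k =
      (Rmap S N w z.2 - Rmap S N z.1 z.2 - (w - z.1) *m L z) -
      (w - z.1) *m (map_mx ratr k - L z).
      by rewrite mulmxBr opprB addrA subrK.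
    apply: le_trans (ler_normB _ _) _; rewrite [e]splitr mulrDl lerD//.
    apply: le_trans (normr_mulmx _ _) _.
    rewrite mulrAC ler_wpM2r// -sK.
    apply: (@le_trans _ _ (n%:R * s)); first by rewrite ler_wpM2l.
    rewrite mulrC ler_pM2l// /K mulrDr mulr1.
    have : 0 <= n%:R * `|N z.1| by rewrite mulr_ge0.
    lra.
  - rewrite -[X in `|X|]subr0 -NL -mulmxBr; apply: le_trans (normr_mulmx _ _) _.
    apply: (@le_trans _ _ (n%:R * `|N z.1| * s)); first by rewrite ler_wpM2l ?mulr_ge0.
    apply: (@le_trans _ _ (K * s)); last by rewrite mulrC sK; lra.
    rewrite ler_pM2r// /K; have : 0 <= n%:R :> R by []; lra.
have [C C0 hC] := tangent_detect hS hN n0 Su.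
apply/ler_addgt0Pr => e e0.
have C3 : 0 < 1 + 3 * C by rewrite ltr_pwDl// mulr_ge0.
have [m hm] := ltr_add_invr (divr_gt0 e0 C3); rewrite add0r in hm.
have [[k d] /= [kc nB hN']] := h m.
move: hm kc nB hN'; set s := m.+1%:R^-1 => hm kc nB hN'.
have s0 : 0 < s by rewrite invr_gt0.
have d0 : 0 < (d.+1%:R^-1 : R) by rewrite invr_gt0.
have nd : \forall w \near within S (nbhs z.1), S w /\ `|w - z.1| <= d.+1%:R^-1.
  apply/nbhs_ballP; exists d.+1%:R^-1 => //= w + Sw.
  by rewrite -ball_normE /ball_/= distrC => /ltW.
have hA : \forall w \near within S (nbhs z.1),
   `|(w - z.1) *m (map_mx ratr k - L z)| <= (2 * s) * `|w - z.1|.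
  apply: (filterS2 _ _ nd (filterI (Rdom_near Dz) (hL _ s0))).
  move=> w [Sw wd] [Dw hw]; have h' := not_bad_secantP Dz nB Sw Dw wd.
  have -> : (w - z.1) *m (map_mx ratr k - L z) =
      (Rmap S N w z.2 - Rmap S N z.1 z.2 - (w - z.1) *m L z) -
      (Rmap S N w z.2 - Rmap S N z.1 z.2 - (w - z.1) *m map_mx ratr k).
    by rewrite mulmxBr [X in _ = _ + X]opprB [RHS]addrC addrA subrK.
  apply: le_trans (ler_normB _ _) _; lra.
have := hC _ _ _ hA; rewrite mulmxBr NL subr0 => /(_ _) hkL.
have {}hkL : `|map_mx ratr k - L z| <= C * (2 * s + `|N z.1 *m map_mx ratr k|).
  by apply: hkL; rewrite mulr_ge0// ltW.
have := normr_entry (map_mx ratr k - L z) i j; rewrite !mxE ler_norml => /andP[h1 _].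
have h2 : C * (2 * s + `|N z.1 *m map_mx ratr k|) <= C * (3 * s).
  by rewrite ler_wpM2l//; lra.
have h3 : (1 + 3 * C) * s <= e by rewrite mulrC -ler_pdivlMr// ltW.
lra.
Qed.

End jacobian.

(** * Borel measurability of the Jacobian *)

Section measurability.
Context d (T : measurableType d) (R : realType).
Implicit Types D : set T.

Lemma measurable_fun_sublevel D (f : T -> R) : measurable D ->
  (forall c, measurable (D `&` [set x | f x <= c])) -> measurable_fun D f.
Proof.
move=> mD h; apply: (measurability _ (RGenOInfty.measurableE R)).
move=> _ [_ [c ->] <-].
have -> : D `&` f @^-1` `]c, +oo[ = D `\` (D `&` [set x | f x <= c]).
  apply/seteqP; split => x [Dx]; rewrite /= in_itv/= andbT ltNge.
    by move=> /negP fc; split=> // -[].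
  by move=> fc; split=> //; apply/negP => ?; exact: fc.
by apply: measurableD.
Qed.

Lemma measurable_mulmx D m n p (A : T -> 'M[R]_(m, n)) (B : T -> 'M[R]_(n, p)) :
  (forall i j, measurable_fun D (fun t => A t i j)) ->
  (forall i j, measurable_fun D (fun t => B t i j)) ->
  forall i j, measurable_fun D (fun t => (A t *m B t) i j).
Proof.
move=> mA mB i j; under eq_fun do rewrite mxE.
by apply: measurable_sum => k; exact: measurable_funM.
Qed.

Lemma measurable_det D m (A : T -> 'M[R]_m) :
  (forall i j, measurable_fun D (fun t => A t i j)) ->
  measurable_fun D (fun t => \det (A t)).
Proof.
move=> mA; rewrite /determinant; apply: measurable_sum => s.
by apply: measurable_funM => //; apply: measurable_prod.
Qed.

Lemma measurable_trmx D m n (A : T -> 'M[R]_(m, n)) :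
  (forall i j, measurable_fun D (fun t => A t i j)) ->
  forall i j, measurable_fun D (fun t => (A t)^T i j).
Proof. by move=> mA i j; under eq_fun do rewrite mxE; exact: mA. Qed.

Lemma measurable_addmx D m n (A B : T -> 'M[R]_(m, n)) :
  (forall i j, measurable_fun D (fun t => A t i j)) ->
  (forall i j, measurable_fun D (fun t => B t i j)) ->
  forall i j, measurable_fun D (fun t => (A t + B t) i j).
Proof.
by move=> mA mB i j; under eq_fun do rewrite mxE; exact: measurable_funD.
Qed.

Lemma measurable_sqrt D (f : T -> R) :
  measurable_fun D f -> measurable_fun D (fun t => Num.sqrt (f t)).
Proof.
move=> mf; apply: (measurableT_comp (f := @Num.sqrt R)) => //.
by apply: continuous_measurable_fun; exact: sqrt_continuous.
Qed.

End measurability.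

Section jacobian.
Variables (R : realType) (n : nat) (S : set 'rV[R]_n) (N : 'rV[R]_n -> 'rV[R]_n).
Local Notation E := 'rV[R]_n.
Local Notation T := (borelRV R n).
Hypothesis n0 : (0 < n)%N.
Hypotheses (hS : smooth_hypersurface S) (hN : is_gauss_map S N).
Hypothesis NS_sigma_compact : sigma_compact ((fun u => (u, N u)) @` S).
Hypothesis Rdiff : forall u u', Rdom1 S N u' u -> S u' -> u <> u' ->
  tdifferentiable S (Rdom1 S N u') (Rmap S N ^~ u') u.

(** A sublevel set of a function of the normal is a projection of a closed part of the graph
of [N]. *)
Lemma gauss_sublevel_sigma_compact (f : E -> R) c : continuous f ->
  sigma_compact (S `&` [set u | f (N u) <= c]).
Proof.
move=> cf; pose F : set (E * E) := [set p | 0 <= (cst c : E * E -> R) p - (f \o snd) p].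
have -> : S `&` [set u | f (N u) <= c] = fst @` (((fun u => (u, N u)) @` S) `&` F).
  apply/seteqP; split => [u [Su fu]|].
    by exists (u, N u) => //; split; [exists u|rewrite /F/= subr_ge0].
  by move=> _ [_ [[u Su <-]] + <-]; rewrite /F/= subr_ge0.
apply: sigma_compact_image; first by prove_continuous.
apply: sigma_compactI_closed => //; apply: closed_ge0; apply: continuous_subr.
  exact: cst_continuous.
have cs : continuous (snd : E * E -> E) by move=> ?; exact: cvg_snd.
by move=> p; exact: (continuous_comp (cs p) (cf p.2)).
Qed.

Lemma gauss_dom_measurable : measurable (S : set T).
Proof.
have -> : S = S `&` [set u | cst 0 (N u) <= 0 :> R].
  by apply/seteqP; split => [u Su|u []//]; split => //=.
apply: sigma_compact_measurableRV; apply: gauss_sublevel_sigma_compact.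
exact: cst_continuous.
Qed.

Lemma measurable_gauss_entry i : measurable_fun (S : set T) (fun u => N u 0 i).
Proof.
apply: measurable_fun_sublevel => [|c]; first exact: gauss_dom_measurable.
apply: sigma_compact_measurableRV.
apply: (gauss_sublevel_sigma_compact (f := fun v => v 0 i)).
exact: coord_continuous.
Qed.

Let L (z : E * E) := tderiv S N (Rdom1 S N z.2) (Rmap S N ^~ z.2) z.1.
Let D : set (T * T) := Rdom S N.

Lemma measurable_tderiv_entry i j : measurable_fun D (fun z => L z i j).
Proof.
have mD : measurable D := measurable_Rdom NS_sigma_compact.
apply: measurable_fun_sublevel => // c.
pose B (m : nat) (p : 'M[rat]_n * nat) : set (T * T) :=
  if ratr (p.1 i j) <= c + m.+1%:R^-1 then
    (D `\` bad_secant S N m.+1%:R^-1 p.2.+1%:R^-1 (map_mx ratr p.1)) `&`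
    ((S `&` [set u | `|N u *m map_mx ratr p.1| <= m.+1%:R^-1]) `*` setT) else set0.
have -> : D `&` [set z | L z i j <= c] = D `&` \bigcap_m \bigcup_p B m p.
  apply/seteqP; split => z [Dz hz]; split=> //.
    move=> m _; have [p [h1 h2 h3]] := (tderiv_entry_le n0 hS hN Rdiff i j c Dz).1 hz m.
    exists p => //; rewrite /B h1; split; first by split.
    by split=> //; split=> //; case: Dz.
  apply/(tderiv_entry_le n0 hS hN Rdiff i j c Dz) => m.
  have [p _] := hz m I; rewrite /B; case: ifP => // h1 [[_ h2] [[_ h3] _]].
  by exists p.
apply: measurableI => //; apply: bigcapT_measurable => m.
apply: countable_bigcupT_measurable => // p; rewrite /B; case: ifP => // _.
apply: measurableI.
  apply: measurableD => //; apply: sigma_compact_measurableRV2.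
  exact: bad_secant_sigma_compact.
apply: measurableX => //; apply: sigma_compact_measurableRV.
apply: (gauss_sublevel_sigma_compact (f := fun v => `|v *m map_mx ratr p.1|)).
by apply: continuous_norm_comp; exact: mulmxr_continuous.
Qed.

Lemma measurable_Jac : measurable_fun D (fun z => Jac S N z.1 z.2).
Proof.
have mD : measurable D := measurable_Rdom NS_sigma_compact.
have mN i j : measurable_fun D (fun z => N z.1 i j).
  rewrite (ord1 i); apply: (measurable_comp (F := S : set T) (f := fun u : T => N u 0 j)).
  - exact: gauss_dom_measurable.
  - by move=> _ [z [Su _ _ _] <-].
  - exact: measurable_gauss_entry.
  - exact: measurable_funTS.
have mL i j : measurable_fun D (fun z => L z i j) by exact: measurable_tderiv_entry.
apply: measurable_sqrt; apply: measurable_det; apply: measurable_addmx.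
  by apply: measurable_mulmx => //; exact: measurable_trmx.
by apply: measurable_mulmx => //; exact: measurable_trmx.
Qed.

End jacobian.

(** * Exchanging the two integrals over the surface *)

Section integration.
Context d (T : measurableType d) (R : realType).

Lemma sigma_finite_measureP (mu : {measure set T -> \bar R}) :
  sigma_finite setT mu ->
  exists nu : {sigma_finite_measure set T -> \bar R}, mu = nu.
Proof.
move=> h; pose H1 := isSFinite.Build _ _ _ _ (sfinite_measure_sigma_finite h).
pose H2 := isSigmaFinite.Build _ _ _ _ h.
pose nu : {sigma_finite_measure set T -> \bar R} := HB.pack (Measure.sort mu) H1 H2.
by exists nu; exact: eq_measure.
Qed.

Lemma integral_setU1_null (mu : {measure set T -> \bar R}) (A : set T) x f :
  measurable A -> measurable [set x] -> mu [set x] = 0%E -> measurable_fun A f ->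
  (\int[mu]_(y in A `|` [set x]) f y = \int[mu]_(y in A) f y)%E.
Proof.
move=> mA mx x0 mf.
have mAx : measurable (A `|` [set x]) by exact: measurableU.
have mfx : measurable_fun (A `|` [set x]) f.
  by apply/measurable_funU => //; split=> //; exact: measurable_fun_set1.
rewrite [LHS]integral_mkcond [RHS]integral_mkcond; apply: ae_eq_integral => //.
- exact/(measurable_restrictT _ _).1.
- exact/(measurable_restrictT _ _).1.
- exists [set x]; split=> // y /= h; apply: contrapT => yx; apply: h => _.
  rewrite /patch; case: ifPn => [|/negP nA].
    by rewrite inE => -[Ay|//]; rewrite mem_set.
  by case: ifPn => // yA; exfalso; apply: nA; apply: mem_set; left; exact: set_mem yA.
Qed.

Lemma integral_patch_EFin (mu : {measure set T -> \bar R}) (A : set T) (f : T -> R) :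
  (\int[mu]_x ((f \_ A) x)%:E = \int[mu]_(x in A) (f x)%:E)%E.
Proof.
rewrite [RHS]integral_mkcond; apply: eq_integral => x _.
by rewrite /patch; case: ifP.
Qed.

(** The slices are integrable only almost everywhere; elsewhere the inner integral takes an
arbitrary finite value, which the outer integral ignores. *)
Lemma Rintegral_Fubini (mu : {sigma_finite_measure set T -> \bar R})
    (f : T * T -> R) : (mu \x mu)%E.-integrable setT (EFin \o f) ->
  \int[mu]_x \int[mu]_y f (x, y) = \int[mu]_y \int[mu]_x f (x, y).
Proof.
move=> fi; rewrite /Rintegral; congr fine.
transitivity (\int[mu]_x \int[mu]_y (f (x, y))%:E)%E.
  apply: ae_eq_integral => //.
  - apply/measurable_EFinP; apply: (measurableT_comp (f := fine)) => //.
    exact: (measurable_fubini_F fi).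
  - exact: (measurable_fubini_F fi).
  - apply: filterS (ae_integrable1 fi) => x ix _.
    by rewrite fineK//; exact: integrable_fin_num.
rewrite (Fubini fi); apply: ae_eq_integral => //.
- exact: (measurable_fubini_G fi).
- apply/measurable_EFinP; apply: (measurableT_comp (f := fine)) => //.
  exact: (measurable_fubini_G fi).
- apply: filterS (ae_integrable2 fi) => x ix _.
  by rewrite fineK//; exact: integrable_fin_num.
Qed.

End integration.

Section wigner.
Variables (R : realType) (n : nat) (S : set 'rV[R]_n) (N : 'rV[R]_n -> 'rV[R]_n).
Local Notation E := 'rV[R]_n.
Local Notation T := (borelRV R n).
Variable sigma : {sigma_finite_measure set T -> \bar R}.
Let D : set (T * T) := Rdom S N.
Hypotheses (mS : measurable (S : set T)) (mD : measurable D).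
Hypothesis mR : measurable_fun D (fun z => Rmap S N z.1 z.2 : T).
Hypothesis mJ : measurable_fun D (fun z => Jac S N z.1 z.2).
Hypothesis point0 : forall u, S u -> sigma [set u] = 0%E.
Hypothesis cov : forall u', S u' ->
  forall Phi : T -> \bar R, measurable_fun (S : set T) Phi ->
  (forall u, S u -> (0 <= Phi u)%E) ->
  (\int[sigma]_(u in Rdom1 S N u') (Phi (Rmap S N u u') * (Jac S N u u')%:E) =
   \int[sigma]_(u in S) Phi u)%E.

Let ysec (u' : E) : set T := [set u | D (u, u')].
Let xsec (u : E) : set T := [set u' | D (u, u')].

Let measurable_ysec u' : measurable (ysec u').
Proof.
have := @pair2_measurable _ _ T T u' measurableT D mD.
by rewrite setTI.
Qed.

Let measurable_xsec u : measurable (xsec u).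
Proof.
have := @pair1_measurable _ _ T T u measurableT D mD.
by rewrite setTI.
Qed.

Let Rdom1E u' : S u' -> Rdom1 S N u' = ysec u' `|` [set u'].
Proof.
move=> Su'; apply/seteqP; split=> u; last first.
  by move=> [[/= Su _ _ h]|/= ->]; split=> //; [right|left].
have [-> _|/eqP uu' [Su [//|h]]] := eqVneq u u'; [by right|left; split=> //].
Qed.

Let Rdom2E u : S u -> Rdom2 S N u = xsec u `|` [set u].
Proof.
move=> Su; apply/seteqP; split=> u'; last first.
  by move=> [[/= _ Su' _ h]|/= ->]; split=> //; [right|left].
have [-> _|/eqP uu' [Su' [//|h]]] := eqVneq u u'; [by right|left; split=> //].
Qed.

Lemma Jac_ge0 u u' : 0 <= Jac S N u u'.
Proof. exact: sqrtr_ge0. Qed.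

(** Apply the change of variables for nonnegative functions to the positive and negative
parts; as [J] is nonnegative they commute with the multiplication by [J]. *)
Lemma Rmap_change_of_variables_real u' (q : E -> R) : S u' ->
  measurable_fun (S : set T) q ->
  (\int[sigma]_(u in Rdom1 S N u') (q (Rmap S N u u') * Jac S N u u')%:E =
   \int[sigma]_(u in S) (q u)%:E)%E.
Proof.
move=> Su' mq; have mq' : measurable_fun (S : set T) (EFin \o q) by exact/measurable_EFinP.
rewrite [LHS]integralE [RHS]integralE; congr (_ - _)%E.
- rewrite -(cov Su') => [|//|u _]; [|exact: measurable_funepos|by rewrite funepos_ge0].
  apply: eq_integral => u _; rewrite !funeposE/= -!EFin_max -EFinM.
  by rewrite maxr_pMl ?Jac_ge0// mul0r.
- rewrite -(cov Su') => [|//|u _]; [|exact: measurable_funeneg|by rewrite funeneg_ge0].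
  apply: eq_integral => u _; rewrite !funenegE/= -!EFin_max -EFinM.
  by rewrite maxr_pMl ?Jac_ge0// mul0r mulNr.
Qed.

(** The slice of [Rdom] and the domain of [u |-> R_u u'] differ by the single point [u'],
which is null. *)
Lemma integral_Rdom1 (F : T * T -> R) u' : measurable_fun D F -> S u' ->
  (\int[sigma]_(u in Rdom1 S N u') (F (u, u'))%:E =
   \int[sigma]_u ((F \_ D) (u, u'))%:E)%E.
Proof.
move=> mF Su'; have mK : measurable_fun setT (F \_ D) by exact/(measurable_restrictT _ _).1.
have inD u : ((u, u') \in D) = (u \in ysec u') by apply/idP/idP; rewrite !inE.
have -> : (\int[sigma]_u ((F \_ D) (u, u'))%:E =
    \int[sigma]_(u in ysec u') (F (u, u'))%:E)%E.
  rewrite [RHS]integral_mkcond; apply: eq_integral => u _.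
  by rewrite /patch inD; case: ifP.
rewrite Rdom1E// integral_setU1_null//; first exact: measurable_set1RV.
  exact: point0.
apply/measurable_EFinP; apply: (eq_measurable_fun (fun u => (F \_ D) (u, u'))) => [u|].
  by rewrite /patch inD => ->.
apply: measurable_funTS; apply: (measurableT_comp mK); exact: pair2_measurable.
Qed.

Lemma integral_Rdom2 (F : T * T -> R) u : measurable_fun D F -> S u ->
  (\int[sigma]_(u' in Rdom2 S N u) (F (u, u'))%:E =
   \int[sigma]_u' ((F \_ D) (u, u'))%:E)%E.
Proof.
move=> mF Su; have mK : measurable_fun setT (F \_ D) by exact/(measurable_restrictT _ _).1.
have inD u' : ((u, u') \in D) = (u' \in xsec u) by apply/idP/idP; rewrite !inE.
have -> : (\int[sigma]_u' ((F \_ D) (u, u'))%:E =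
    \int[sigma]_(u' in xsec u) (F (u, u'))%:E)%E.
  rewrite [RHS]integral_mkcond; apply: eq_integral => u' _.
  by rewrite /patch inD; case: ifP.
rewrite Rdom2E// integral_setU1_null//; first exact: measurable_set1RV.
  exact: point0.
apply/measurable_EFinP; apply: (eq_measurable_fun (fun u' => (F \_ D) (u, u'))) => [u'|].
  by rewrite /patch inD => ->.
apply: measurable_funTS; apply: (measurableT_comp mK); exact: pair1_measurable.
Qed.

Definition wigner_kernel (p q : E -> R) (z : T * T) : R :=
  p z.2 * q (Rmap S N z.1 z.2) * Jac S N z.1 z.2.

Lemma measurable_wigner_kernel (p q : E -> R) :
  measurable_fun (S : set T) p -> measurable_fun (S : set T) q ->
  measurable_fun D (wigner_kernel p q).
Proof.
move=> mp mq; apply: measurable_funM => //; apply: measurable_funM.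
  apply: (measurable_comp (F := S : set T) (f := p : T -> R)) => //.
    by move=> _ [z [_ Sz _ _] <-].
  exact: measurable_funTS.
apply: (measurable_comp (F := S : set T) (f := q : T -> R)) => //.
by move=> _ [z Dz <-]; have [] := Rmap_rel Dz.
Qed.

(** The change of variables, applied to [p u' * q], removes the dependence on [u] from
the integral. *)
Lemma wigner_kernel_integral1 (p q : E -> R) u' :
  measurable_fun (S : set T) p -> sigma.-integrable S (EFin \o q) ->
  (\int[sigma]_u ((wigner_kernel p q \_ D) (u, u'))%:E =
   (((fun u' => p u' * \int[sigma]_(u in S) q u) \_ S) u')%:E)%E.
Proof.
move=> mp iq; have mq : measurable_fun (S : set T) q.
  by apply/measurable_EFinP; exact: (measurable_int _ iq).
rewrite [in RHS]/patch; case: ifPn => [|/negP nS]; last first.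
  rewrite (eq_integral (fun=> 0%E)) ?integral0// => u _; rewrite /patch.
  by case: ifPn => // /set_mem[_ /= Su' _ _]; exfalso; apply: nS; exact: mem_set.
move=> /set_mem Su'; rewrite -integral_Rdom1//; last exact: measurable_wigner_kernel.
rewrite (Rmap_change_of_variables_real Su' (q := fun u => p u' * q u)); last first.
  exact: measurable_funM.
under eq_integral do rewrite EFinM.
rewrite integralZl// /Rintegral EFinM fineK//.
exact: (integrable_fin_num _ iq).
Qed.

Lemma wigner_kernel_abs_integral1 (p q : E -> R) u' :
  measurable_fun (S : set T) p -> sigma.-integrable S (EFin \o q) ->
  (\int[sigma]_u `|((wigner_kernel p q \_ D) (u, u'))%:E| =
   (((fun u' => `|p u'| * \int[sigma]_(u in S) `|q u|) \_ S) u')%:E)%E.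
Proof.
move=> mp iq; pose absp (u : E) : R := `|p u|; pose absq (u : E) : R := `|q u|.
have map' : measurable_fun (S : set T) absp by exact: measurableT_comp.
have iaq : sigma.-integrable S (EFin \o absq) by exact: integrable_abse iq.
rewrite -(wigner_kernel_integral1 u' map' iaq); apply: eq_integral => u _ /=.
rewrite /patch; case: ifP => _; last by rewrite normr0.
by rewrite /wigner_kernel !normrM (ger0_norm (Jac_ge0 _ _)).
Qed.

Lemma wigner_kernel_integrable1 (p q : E -> R) u' :
  measurable_fun (S : set T) p -> sigma.-integrable S (EFin \o q) ->
  sigma.-integrable setT (fun u => ((wigner_kernel p q \_ D) (u, u'))%:E).
Proof.
move=> mp iq; have mq : measurable_fun (S : set T) q.
  by apply/measurable_EFinP; exact: (measurable_int _ iq).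
apply/integrableP; split; last by rewrite wigner_kernel_abs_integral1// ltry.
apply/measurable_EFinP.
have mK : measurable_fun setT (wigner_kernel p q \_ D).
  apply/(measurable_restrictT _ _).1 => //; exact: measurable_wigner_kernel.
by apply: (measurableT_comp mK); exact: pair2_measurable.
Qed.

Lemma wigner_kernel_integrable (p q : E -> R) :
  sigma.-integrable S (EFin \o p) -> sigma.-integrable S (EFin \o q) ->
  (sigma \x sigma)%E.-integrable setT (EFin \o (wigner_kernel p q \_ D)).
Proof.
move=> ip iq.
have mp : measurable_fun (S : set T) p.
  by apply/measurable_EFinP; exact: (measurable_int _ ip).
have mq : measurable_fun (S : set T) q.
  by apply/measurable_EFinP; exact: (measurable_int _ iq).
apply/integrable21ltyP.
  apply/measurable_EFinP; apply/(measurable_restrictT _ _).1 => //.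
  exact: measurable_wigner_kernel.
under eq_integral do rewrite wigner_kernel_abs_integral1//.
rewrite integral_patch_EFin; under eq_integral do rewrite EFinM muleC.
have iap := integrable_abse ip.
rewrite integralZl//; apply: lte_mul_pinfty => //.
  by rewrite lee_fin; apply: Rintegral_ge0 => u _; exact: normr_ge0.
by have /integrableP[_] := ip.
Qed.

(** Both the real and the imaginary part of the Wigner integrand are sums of two kernels
[p u' * q (R_u u') * J (u, u')]. *)
Lemma wigner_integral (p1 q1 p2 q2 : E -> R) :
  sigma.-integrable S (EFin \o p1) -> sigma.-integrable S (EFin \o q1) ->
  sigma.-integrable S (EFin \o p2) -> sigma.-integrable S (EFin \o q2) ->
  \int[sigma]_(u in S) \int[sigma]_(u' in Rdom2 S N u)
    ((p1 u' * q1 (Rmap S N u u') + p2 u' * q2 (Rmap S N u u')) * Jac S N u u') =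
  (\int[sigma]_(u in S) p1 u) * (\int[sigma]_(u in S) q1 u) +
  (\int[sigma]_(u in S) p2 u) * (\int[sigma]_(u in S) q2 u).
Proof.
move=> ip1 iq1 ip2 iq2.
have mf f : sigma.-integrable S (EFin \o f) -> measurable_fun (S : set T) f.
  by move=> i; apply/measurable_EFinP; exact: (measurable_int _ i).
pose F z := wigner_kernel p1 q1 z + wigner_kernel p2 q2 z.
have mF : measurable_fun D F.
  by apply: measurable_funD; apply: measurable_wigner_kernel; exact: mf.
have FD z : (F \_ D) z = (wigner_kernel p1 q1 \_ D) z + (wigner_kernel p2 q2 \_ D) z.
  by rewrite /patch; case: ifP => // _; rewrite addr0.
have iF : (sigma \x sigma)%E.-integrable setT (EFin \o (F \_ D)).
  have := integrableD measurableT (wigner_kernel_integrable ip1 iq1)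
    (wigner_kernel_integrable ip2 iq2).
  by apply: eq_integrable => // z _ /=; rewrite FD.
transitivity (\int[sigma]_u \int[sigma]_u' (F \_ D) (u, u')).
  rewrite Rintegral_mkcond; apply: eq_Rintegral => u _; rewrite {1}/patch.
  case: ifPn => [|/negP nS].
    rewrite inE => Su; rewrite /Rintegral -integral_Rdom2//; congr fine.
    by apply: eq_integral => u' _; rewrite /F /wigner_kernel mulrDl.
  rewrite /Rintegral integral0_eq// => u' _.
  by rewrite /patch; case: ifPn => // /set_mem[/= Su _ _ _]; exfalso; apply: nS; exact: mem_set.
rewrite Rintegral_Fubini//.
pose c (q : E -> R) : R := \int[sigma]_(u in S) q u.
transitivity (\int[sigma]_(u' in S) (p1 u' * c q1 + p2 u' * c q2)).
  rewrite [RHS]Rintegral_mkcond; apply: eq_Rintegral => u' _.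
  rewrite /Rintegral; under eq_integral do rewrite FD EFinD.
  rewrite integralD//; [|by apply: wigner_kernel_integrable1 => //; exact: mf..].
  rewrite !wigner_kernel_integral1//; [|exact: mf|exact: mf].
  by rewrite /patch; case: ifP => // _; rewrite adde0.
have ipc (p q : E -> R) : sigma.-integrable S (EFin \o p) ->
   sigma.-integrable S (EFin \o (fun u' => p u' * c q)).
  by move=> ip; exact: (integrableZr mS (c q) ip).
rewrite RintegralD//; [|exact: ipc|exact: ipc].
by rewrite !RintegralZr.
Qed.

End wigner.

(** * Phases, integrability and the identity *)

Lemma continuous_measurable_RV (R : realType) n (f : 'rV[R]_n -> R) :
  continuous f -> measurable_fun setT (f : borelRV R n -> R).
Proof.
move=> cf; apply: measurable_fun_sublevel => // c; rewrite setTI.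
apply: measurable_closedRV.
by apply: (@closed_comp _ _ f [set y | y <= c]) => //; exact: closed_le.
Qed.

Section integrability.
Context d (T : measurableType d) (R : realType).
Variables (mu : {measure set T -> \bar R}) (S : set T).
Hypothesis mS : measurable S.

Lemma ae_imply (P Q : T -> Prop) :
  (forall u, P u -> Q u) -> {ae mu, forall u, P u} -> {ae mu, forall u, Q u}.
Proof. by move=> PQ; apply: filterS => u; exact: PQ. Qed.

(** Off [K] the function vanishes almost everywhere, and on [K] it satisfies
[|f| <= 1 + f ^ 2 <= 1 + w]. *)
Lemma integrable_L2_support (K : set T) (f w : T -> R) :
  measurable K -> (mu K < +oo)%E ->
  measurable_fun S f -> measurable_fun S w ->
  (forall u, f u ^+ 2 <= w u) -> (\int[mu]_(u in S) (w u)%:E < +oo)%E ->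
  {ae mu, forall u, S u -> ~ K u -> f u = 0} ->
  mu.-integrable S (EFin \o f).
Proof.
move=> mK Koo mf mw fw woo aef.
have w0 u : 0 <= w u by apply: le_trans (fw u); exact: sqr_ge0.
have mK1 : measurable_fun S (fun u => \1_K u : R) by exact: measurable_indic.
apply/integrableP; split; first exact/measurable_EFinP.
apply: (@le_lt_trans _ _ (\int[mu]_(u in S) ((\1_K u)%:E + (w u)%:E))%E).
  apply: ae_ge0_le_integral => //.
  - by apply: measurableT_comp => //; exact/measurable_EFinP.
  - by move=> u _; rewrite -EFinD lee_fin addr_ge0.
  - by apply/measurable_EFinP; exact: measurable_funD.
  apply: filterS aef => u hu Su; rewrite /= -EFinD lee_fin.
  have [Ku|nK] := pselect (K u); last first.
    by rewrite hu// normr0 addr_ge0.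
  rewrite indicE mem_set// (le_trans _ (lerD (lexx 1) (fw u)))//.
  rewrite -[f u ^+ 2]real_normK ?num_real//.
  by have := sqr_ge0 (`|f u| - 1); have := normr_ge0 (f u); nra.
rewrite ge0_integralD//; try by [exact/measurable_EFinP | move=> u _; rewrite lee_fin].
rewrite integral_indic//; apply: lte_add_pinfty => //.
apply: le_lt_trans Koo; apply: le_measure; rewrite ?inE//; exact: measurableI.
Qed.

Lemma integrable_mul_bounded (f h : T -> R) :
  mu.-integrable S (EFin \o f) -> measurable_fun S h -> (forall u, `|h u| <= 1) ->
  mu.-integrable S (EFin \o (fun u => f u * h u)).
Proof.
move=> fi mh h1; apply: (le_integrable mS _ _ fi).
  apply/measurable_EFinP; apply: measurable_funM => //.
  by apply/measurable_EFinP; exact: (measurable_int _ fi).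
by move=> u _ /=; rewrite lee_fin normrM ler_piMr.
Qed.

End integrability.

Section fourier_kernel.
Variable R : realType.
Implicit Types s t : R.

Lemma exp_m2ipiB s t : exp_m2ipi (s - t) = exp_m2ipi s * conjc (exp_m2ipi t).
Proof.
rewrite /exp_m2ipi mulrBr cosB sinB.
apply/eqP; rewrite eq_complex/=; apply/andP; split; apply/eqP; ring.
Qed.

Lemma normC_sqr (a b : R) : `|Complex a b| ^+ 2 = Complex (a * a + b * b) 0.
Proof.
have -> : `|Complex a b| = Complex (Num.sqrt (a ^+ 2 + b ^+ 2)) 0 by [].
apply/eqP; rewrite eq_complex/= mulr0 subr0 -expr2 sqr_sqrtr ?addr_ge0 ?sqr_ge0//.
by rewrite !expr2 mulr0 mul0r addr0 !eqxx.
Qed.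

End fourier_kernel.

Section dot.
Variables (R : realType) (n : nat).
Implicit Types u v w : 'rV[R]_n.

Lemma dotBl u v w : dot (u - v) w = dot u w - dot v w.
Proof. by rewrite /dot mulmxBl !mxE. Qed.

Lemma dotZl (a : R) u w : dot (a *: u) w = a * dot u w.
Proof. by rewrite /dot -scalemxAl mxE. Qed.

Lemma dotC u w : dot u w = dot w u.
Proof.
have uw : u *m w^T = (w *m u^T)^T by rewrite trmx_mul trmxK.
by rewrite /dot uw mxE.
Qed.

Lemma dotBr u v w : dot u (v - w) = dot u v - dot u w.
Proof. by rewrite dotC dotBl !(dotC u). Qed.

Lemma dot_tproj (N : 'rV[R]_n -> 'rV[R]_n) u x w :
  dot w (N u) = 0 -> dot (tproj N u x) w = dot x w.
Proof. by move=> h; rewrite dotBl dotZl (dotC (N u)) h mulr0 subr0. Qed.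

End dot.

Section proposition.
Variables (R : realType) (n : nat) (S : set 'rV[R]_n) (N : 'rV[R]_n -> 'rV[R]_n).
Local Notation E := 'rV[R]_n.
Local Notation T := (borelRV R n).

Lemma Rmap_orthogonal u u' : Rdom2 S N u u' -> dot (u' - Rmap S N u u') (N u) = 0.
Proof.
move=> [Su' h]; rewrite /Rmap; case: eqP => [_|uu'].
  by rewrite subrr /dot mul0mx mxE.
case: h => // -[c [hc _]].
by have [] := xgetPex u' (ex_intro (Rrel S N u u') c hc).
Qed.

Lemma surface_sigma_finite (sigma : {measure set T -> \bar R}) :
  smooth_hypersurface S -> is_gauss_map S N -> is_surface_measure S sigma ->
  sigma_finite setT sigma /\ sigma_compact ((fun u => (u, N u)) @` S).
Proof.
move=> hS hN hsigma.
have [K [cK KS SE Kfin cG]] := countable_pieces hS hN hsigma.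
have mK i : measurable (K i : set T).
  by apply: sigma_compact_measurableRV; exact: compact_sigma_compact.
split.
  exists (fun i => if i is k.+1 then K k else ~` S).
    apply/seteqP; split=> // u _; have [Su|nSu] := pselect (S u); last by exists 0.
    by move: Su; rewrite {1}SE => -[i _ Ki]; exists i.+1.
  move=> [|i]; last by split.
  have [sS _] := hsigma; split; last by rewrite sS ltry.
  apply: measurableC; rewrite SE; exact: bigcupT_measurable.
exists (fun i => (fun u => (u, N u)) @` K i) => //.
by rewrite {1}SE image_bigcup.
Qed.

End proposition.

Theorem proposition4p8 (R : realType) (n : nat) (hn : (2 <= n)%N)
    (S : set 'rV[R]_n) (N : 'rV[R]_n -> 'rV[R]_n)
    (sigma : {measure set (borelRV R n) -> \bar R})
    (hS : smooth_hypersurface S) (hN : is_gauss_map S N)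
    (hsigma : is_surface_measure S sigma)
    (hstd : standing_assumptions S N sigma)
    (g : 'rV[R]_n -> R[i])
    (hg : L2_on S sigma g) (hgc : compactly_supported S sigma g)
    (x : 'rV[R]_n) :
  `|fourier S sigma g x| ^+ 2 =
  XSstar S N sigma (wigner S N sigma g g) x.
Proof.
have n0 : (0 < n)%N by rewrite (leq_trans _ hn).
have [sfin sG] := surface_sigma_finite hS hN hsigma.
have point0 u : S u -> sigma [set u] = 0%E by exact: (surface_point0 hS hsigma hn).
have mS := gauss_dom_measurable sG.
have mD := measurable_Rdom sG.
have mR := measurable_Rmap sG.
have mJ := measurable_Jac n0 hS hN sG (Rmap_diff1 hstd).
have [mRe mIm L2] := hg; have [K [cK KS aeK]] := hgc.
have mK : measurable (K : set (borelRV R n)).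
  by apply: sigma_compact_measurableRV; exact: compact_sigma_compact.
have Kfin := compact_surface_fin hS hN hsigma cK KS.
have cov := Rmap_change_of_variables hstd.
pose w u : R := complex.Re (g u) ^+ 2 + complex.Im (g u) ^+ 2.
have mw : measurable_fun (S : set (borelRV R n)) w.
  by apply: measurable_funD; apply: measurable_funX.
have iRe : sigma.-integrable S (EFin \o (fun u => complex.Re (g u))).
  apply: (integrable_L2_support mS mK Kfin (w := w)) => //.
    by move=> u; rewrite lerDl sqr_ge0.
  by apply: ae_imply aeK => u h Su nK; rewrite h.
have iIm : sigma.-integrable S (EFin \o (fun u => complex.Im (g u))).
  apply: (integrable_L2_support mS mK Kfin (w := w)) => //.
    by move=> u; rewrite lerDr sqr_ge0.
  by apply: ae_imply aeK => u h Su nK; rewrite h.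
have cphase : continuous (fun u : 'rV[R]_n => 2 * pi * dot x u).
  apply: continuous_mulr_cst; apply: continuous_dot.
    exact: cst_continuous.
  exact: continuous_idfun.
have mcos : measurable_fun (S : set (borelRV R n)) (fun u => cos (2 * pi * dot x u)).
  apply: measurable_funTS; apply: continuous_measurable_RV => u.
  exact: (continuous_comp (cphase u) (@continuous_cos R _)).
have msin : measurable_fun (S : set (borelRV R n)) (fun u => sin (2 * pi * dot x u)).
  apply: measurable_funTS; apply: continuous_measurable_RV => u.
  exact: (continuous_comp (cphase u) (@continuous_sin R _)).
pose G u := g u * exp_m2ipi (dot x u).
pose a u := complex.Re (G u); pose b u := complex.Im (G u).
have ia : sigma.-integrable S (EFin \o a).
  have h1 := integrable_mul_bounded mS iRe mcos (fun u => cos_max _).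
  have h2 := integrable_mul_bounded mS iIm msin (fun u => sin_max _).
  have := integrableD mS h1 h2; apply: eq_integrable => // u _ /=.
  by rewrite -EFinD /a /G /exp_m2ipi; case: (g u) => c e /=; congr EFin; ring.
have ib : sigma.-integrable S (EFin \o b).
  have h1 := integrable_mul_bounded mS iIm mcos (fun u => cos_max _).
  have h2 := integrable_mul_bounded mS iRe msin (fun u => sin_max _).
  have := integrableB mS h1 h2; apply: eq_integrable => // u _ /=.
  by rewrite -EFinB /b /G /exp_m2ipi; case: (g u) => c e /=; congr EFin; ring.
(* The imaginary part of the kernel is antisymmetric in [a] and [b]; its integral is
   [(\int b) (\int a) - (\int a) (\int b) = 0]. *)
have iNa : sigma.-integrable S (EFin \o (fun u => -1 * a u)).
  exact: (integrableZl mS (-1) ia).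
have integrandE u u' : Rdom2 S N u u' ->
    g u' * conjc (g (Rmap S N u u')) *
      exp_m2ipi (dot (tproj N u x) (u' - Rmap S N u u')) * (Jac S N u u')%:C%C =
    Complex ((a u' * a (Rmap S N u u') + b u' * b (Rmap S N u u')) * Jac S N u u')
            ((b u' * a (Rmap S N u u') + -1 * a u' * b (Rmap S N u u')) * Jac S N u u').
  move=> Du; rewrite dot_tproj; last exact: Rmap_orthogonal.
  rewrite dotBr exp_m2ipiB /a /b /G.
  case: (g u') (g (Rmap S N u u')) => [c e] [c' e'].
  case: (exp_m2ipi (dot x u')) (exp_m2ipi (dot x (Rmap S N u u'))) => [C s] [C' s'].
  by apply/eqP; rewrite eq_complex/=; apply/andP; split; apply/eqP; ring.
have [nu sigma_nu] := sigma_finite_measureP sfin.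
subst sigma.
have WI := wigner_integral mS mD mR mJ point0 cov.
rewrite /fourier /Cintegral normC_sqr /XSstar /Cintegral; congr Complex.
- rewrite -(WI _ _ _ _ ia ia ib ib); apply: eq_Rintegral => u _.
  by apply: eq_Rintegral => u' /set_mem Du; rewrite integrandE.
- have := WI _ _ _ _ ib ia iNa ib; rewrite RintegralZl// mulN1r mulNr mulrC subrr.
  move=> <-; apply: eq_Rintegral => u _.
  by apply: eq_Rintegral => u' /set_mem Du; rewrite integrandE.
Qed.
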